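(* Let $\mathcal D\subset\mathbb R^2$ be a domain, and let $\lambda(u,v)$, $\mu(u,v)$ and $\nu=\nu(u)$ (a function depending only on $u$) be smooth real functions on $\mathcal D$ such that $\mu$ and $\nu$ vanish nowhere, $\nu$ is not constant, and $$\nu_u+\lambda_v=\lambda\,(\ln|\mu|)_v,$$ $$|\mu|\,(\ln|\mu|)_{uv}=-\nu^2.$$ Let $(u_0,v_0)\in\mathcal D$, let $p_0\in\mathbb R^4_1$, and let $\{x_0,y_0,(n_1)_0,(n_2)_0\}$ be a pseudo-orthonormal frame at $p_0$. Then there exist a subdomain $\mathcal D_0\subset\mathcal D$ containing $(u_0,v_0)$ and a unique timelike surface $\mathcal M: z=z(u,v)$, $(u,v)\in\mathcal D_0$, in $\mathbb R^4_1$ with parallel normalized mean curvature vector field such that: (i) $z(u_0,v_0)=p_0$; (ii) $K-H^2=0$ on $\mathcal M$; (iii) $(u,v)$ are canonical isotropic parameters of $\mathcal M$; (iv) $\mathcal M$ has a geometric frame field $\{x,y,n_1,n_2\}$ on $\mathcal D_0$ equal to $\{x_0,y_0,(n_1)_0,(n_2)_0\}$ at $(u_0,v_0)$, and with respect to it $\lambda,\mu,\nu$ are the geometric functions of $\mathcal M$.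
   Context: $\mathbb R^4_1$ is $\mathbb R^4$ with the metric $\langle\cdot,\cdot\rangle=dx_1^2+dx_2^2+dx_3^2-dx_4^2$ and flat Levi-Civita connection $\widetilde\nabla$. A domain is an open connected set. A surface $\mathcal M: z=z(u,v)$ is a smooth immersion of a domain of $\mathbb R^2$ into $\mathbb R^4_1$; it is timelike if the induced metric is Lorentzian. $\sigma$ is the second fundamental tensor (normal part of $\widetilde\nabla_xy$ for tangent $x,y$), $D$ the normal connection (normal part of $\widetilde\nabla_x\xi$ for normal $\xi$), $H=\tfrac12\mathrm{tr}\,\sigma$ the mean curvature vector field, $K$ the Gauss curvature of the induced metric, and $H^2=\langle H,H\rangle$. A normal field $\xi$ is parallel if $D\xi=0$. $\mathcal M$ has parallel normalized mean curvature vector field if $H$ is nowhere zero, $H$ is not parallel, and there is a unit normal vector field in the direction of $H$ which is parallel. A pseudo-orthonormal frame at a point is a basis $\{x,y,n_1,n_2\}$ of $\mathbb R^4_1$ with $\langle x,x\rangle=\langle y,y\rangle=0$, $\langle x,y\rangle=-1$, $\langle n_1,n_1\rangle=\langle n_2,n_2\rangle=1$, and $\langle n_1,n_2\rangle=\langle x,n_i\rangle=\langle y,n_i\rangle=0$ for $i=1,2$. Parameters $(u,v)$ are isotropic if $\langle z_u,z_u\rangle=\langle z_v,z_v\rangle=0$ and $\langle z_u,z_v\rangle=-f^2$ for a smooth function $f>0$ (the metric function). For isotropic parameters with $H$ nowhere zero, a geometric frame field is a smooth pseudo-orthonormal frame field $\{x,y,n_1,n_2\}$ along $\mathcal M$ with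 $x=z_u/f$, $y=z_v/f$, $n_1$ a unit normal field collinear with $H$, and $n_2$ a unit normal field orthogonal to $n_1$. For a timelike surface with parallel normalized mean curvature vector field and $K-H^2=0$ everywhere, isotropic parameters are canonical if, with respect to a geometric frame field, $$\sigma(x,x)=\lambda n_1+\mu n_2,\quad \sigma(x,y)=-\nu n_1,\quad \sigma(y,y)=0,$$ where $\mu\ne0$ and $f=\dfrac{1}{\sqrt{|\mu|}}$. The functions $\lambda,\mu,\nu$ appearing here are the geometric functions of the surface (thus $H=\nu n_1$). *)

(* Defs.v *)
From Stdlib Require Export Reals List.
From Coquelicot Require Export Coquelicot.
Open Scope R_scope.

(** * Functions of two real variables

Functions on a domain [D] of the plane are represented by total functions on
[R * R]; only their values on the open set [D] matter, since every notion
below is local. *)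

Inductive dir := Du | Dv.

Definition sumd (F : dir -> R) : R := F Du + F Dv.

Definition domain (D : R * R -> Prop) : Prop :=
  open D /\
  (exists p, D p) /\
  (forall A B : R * R -> Prop, open A -> open B ->
     (forall p, D p -> A p \/ B p) ->
     (exists p, D p /\ A p) -> (exists p, D p /\ B p) ->
     exists p, D p /\ A p /\ B p).

Definition ex_pd (i : dir) (f : R * R -> R) (p : R * R) : Prop :=
  match i with
  | Du => ex_derive (fun t => f (t, snd p)) (fst p)
  | Dv => ex_derive (fun t => f (fst p, t)) (snd p)
  end.

Definition pd (i : dir) (f : R * R -> R) (p : R * R) : R :=
  match i with
  | Du => Derive (fun t => f (t, snd p)) (fst p)
  | Dv => Derive (fun t => f (fst p, t)) (snd p)
  end.

Definition iter_pd (l : list dir) (f : R * R -> R) : R * R -> R :=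
  fold_right pd f l.

(** C^infinity on [D]: all iterated partial derivatives exist and are
continuous at the points of [D]. *)
Definition smooth (D : R * R -> Prop) (f : R * R -> R) : Prop :=
  forall (l : list dir) (p : R * R), D p ->
    continuous (iter_pd l f) p /\ forall i, ex_pd i (iter_pd l f) p.

(** * Minkowski space *)

Definition R4 : NormedModule R_AbsRing :=
  prod_NormedModule R_AbsRing
    (prod_NormedModule R_AbsRing
      (prod_NormedModule R_AbsRing R_NormedModule R_NormedModule)
      R_NormedModule)
    R_NormedModule.

Definition vec (a1 a2 a3 a4 : R) : R4 := (a1, a2, a3, a4).

Definition c1 (a : R4) : R := fst (fst (fst a)).
Definition c2 (a : R4) : R := snd (fst (fst a)).
Definition c3 (a : R4) : R := snd (fst a).
Definition c4 (a : R4) : R := snd a.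

Definition mink (a b : R4) : R :=
  c1 a * c1 b + c2 a * c2 b + c3 a * c3 b - c4 a * c4 b.

Definition vsmooth (D : R * R -> Prop) (z : R * R -> R4) : Prop :=
  smooth D (fun p => c1 (z p)) /\ smooth D (fun p => c2 (z p)) /\
  smooth D (fun p => c3 (z p)) /\ smooth D (fun p => c4 (z p)).

Definition vpd (i : dir) (z : R * R -> R4) (p : R * R) : R4 :=
  vec (pd i (fun q => c1 (z q)) p) (pd i (fun q => c2 (z q)) p)
      (pd i (fun q => c3 (z q)) p) (pd i (fun q => c4 (z q)) p).

Definition lincomb (x y n1 n2 : R4) (c : R * R * R * R) : R4 :=
  let '(a, b, c, d) := c in
  plus (plus (scal a x) (scal b y)) (plus (scal c n1) (scal d n2)).

Definition is_basis (x y n1 n2 : R4) : Prop :=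
  forall w : R4, exists! c, w = lincomb x y n1 n2 c.

Definition pseudo_orthonormal (x y n1 n2 : R4) : Prop :=
  is_basis x y n1 n2 /\
  mink x x = 0 /\ mink y y = 0 /\ mink x y = -1 /\
  mink n1 n1 = 1 /\ mink n2 n2 = 1 /\ mink n1 n2 = 0 /\
  mink x n1 = 0 /\ mink x n2 = 0 /\ mink y n1 = 0 /\ mink y n2 = 0.

(** * Surfaces *)

Definition tangent (z : R * R -> R4) (p : R * R) (w : R4) : Prop :=
  exists a b : R, w = plus (scal a (vpd Du z p)) (scal b (vpd Dv z p)).

Definition normal (z : R * R -> R4) (p : R * R) (w : R4) : Prop :=
  forall t, tangent z p t -> mink w t = 0.

Definition immersion (D : R * R -> Prop) (z : R * R -> R4) : Prop :=
  vsmooth D z /\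
  forall p, D p -> forall a b : R,
    plus (scal a (vpd Du z p)) (scal b (vpd Dv z p)) = zero -> a = 0 /\ b = 0.

Definition timelike_surface (D : R * R -> Prop) (z : R * R -> R4) : Prop :=
  domain D /\ immersion D z /\
  forall p, D p -> exists e1 e2 : R4,
    tangent z p e1 /\ tangent z p e2 /\
    mink e1 e1 = 1 /\ mink e2 e2 = -1 /\ mink e1 e2 = 0.

Definition metric (z : R * R -> R4) (i j : dir) (p : R * R) : R :=
  mink (vpd i z p) (vpd j z p).

Definition metric_det (z : R * R -> R4) (p : R * R) : R :=
  metric z Du Du p * metric z Dv Dv p - metric z Du Dv p * metric z Dv Du p.

Definition metric_inv (z : R * R -> R4) (i j : dir) (p : R * R) : R :=
  match i, j with
  | Du, Du => metric z Dv Dv p / metric_det z p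
  | Du, Dv => - metric z Du Dv p / metric_det z p
  | Dv, Du => - metric z Dv Du p / metric_det z p
  | Dv, Dv => metric z Du Du p / metric_det z p
  end.

(** Coordinates of the tangential part of [w] in the basis [z_u, z_v]. *)
Definition tcoord (z : R * R -> R4) (i : dir) (p : R * R) (w : R4) : R :=
  sumd (fun j => metric_inv z i j p * mink w (vpd j z p)).

Definition tangent_part (z : R * R -> R4) (p : R * R) (w : R4) : R4 :=
  plus (scal (tcoord z Du p w) (vpd Du z p))
       (scal (tcoord z Dv p w) (vpd Dv z p)).

Definition normal_part (z : R * R -> R4) (p : R * R) (w : R4) : R4 :=
  minus w (tangent_part z p w).

Lemma mink_lincomb2 (a b : R) (v1 v2 w : R4) :
  mink w (plus (scal a v1) (scal b v2)) = a * mink w v1 + b * mink w v2.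
Proof.
destruct v1 as [[[? ?] ?] ?]; destruct v2 as [[[? ?] ?] ?].
destruct w as [[[? ?] ?] ?].
unfold mink, c1, c2, c3, c4, plus, scal; simpl.
unfold plus, scal; simpl; unfold mult; simpl; ring.
Qed.

Lemma mink_normal_part (z : R * R -> R4) (p : R * R) (w t : R4) :
  mink (normal_part z p w) t = mink w t - mink (tangent_part z p w) t.
Proof.
unfold normal_part; set (u := tangent_part z p w).
destruct u as [[[? ?] ?] ?]; destruct w as [[[? ?] ?] ?].
destruct t as [[[? ?] ?] ?].
unfold mink, c1, c2, c3, c4, minus, plus, opp; simpl.
unfold plus, opp; simpl; ring.
Qed.

Lemma mink_sym (v w : R4) : mink v w = mink w v.
Proof. unfold mink; ring. Qed.

(** [w = tangent_part + normal_part] is the orthogonal decomposition of [w]. *)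
Lemma normal_part_spec (z : R * R -> R4) (p : R * R) (w : R4) :
  metric_det z p <> 0 ->
  tangent z p (tangent_part z p w) /\ normal z p (normal_part z p w).
Proof.
intros H; split.
  now exists (tcoord z Du p w), (tcoord z Dv p w).
intros t [a [b ->]].
rewrite mink_normal_part, !mink_lincomb2.
rewrite !(mink_sym (tangent_part z p w)).
unfold tangent_part; rewrite !mink_lincomb2.
unfold tcoord, sumd, metric_inv.
revert H; unfold metric_det, metric.
rewrite !(mink_sym (vpd Dv z p) (vpd Du z p)).
intros H; field; exact H.
Qed.

(** Flat derivative at [p], in the direction of the tangent vector [w], of a
vector field [Y] along the surface. *)
Definition flat_conn (z : R * R -> R4) (p : R * R) (w : R4)
    (Y : R * R -> R4) : R4 :=
  plus (scal (tcoord z Du p w) (vpd Du Y p))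
       (scal (tcoord z Dv p w) (vpd Dv Y p)).

Definition sigma (z X Y : R * R -> R4) (p : R * R) : R4 :=
  normal_part z p (flat_conn z p (X p) Y).

Definition normal_conn (z : R * R -> R4) (p : R * R) (w : R4)
    (xi : R * R -> R4) : R4 :=
  normal_part z p (flat_conn z p w xi).

(** Half the trace of [sigma] with respect to the induced metric. *)
Definition mean_curv (z : R * R -> R4) (p : R * R) : R4 :=
  let s i j := scal (metric_inv z i j p) (sigma z (vpd i z) (vpd j z) p) in
  scal (1 / 2) (plus (plus (s Du Du) (s Du Dv)) (plus (s Dv Du) (s Dv Dv))).

(** [christoffel z k i j] is the [k]-th coordinate of the Levi-Civita
derivative of the [j]-th coordinate field along the [i]-th one. *)
Definition christoffel (z : R * R -> R4) (k i j : dir) (p : R * R) : R :=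
  1 / 2 * sumd (fun l => metric_inv z k l p *
    (pd i (metric z j l) p + pd j (metric z i l) p - pd l (metric z i j) p)).

(** [l]-th coordinate of [R(d_u, d_v) d_v], where
[R(X, Y) = nabla_X nabla_Y - nabla_Y nabla_X - nabla_[X, Y]]. *)
Definition riemann (z : R * R -> R4) (l : dir) (p : R * R) : R :=
  pd Du (christoffel z l Dv Dv) p - pd Dv (christoffel z l Du Dv) p +
  sumd (fun m => christoffel z l Du m p * christoffel z m Dv Dv p -
                 christoffel z l Dv m p * christoffel z m Du Dv p).

Definition gauss_curv (z : R * R -> R4) (p : R * R) : R :=
  sumd (fun l => metric z l Du p * riemann z l p) / metric_det z p.

Definition parallel (D : R * R -> Prop) (z xi : R * R -> R4) : Prop :=
  forall p, D p -> forall w, tangent z p w -> normal_conn z p w xi = zero.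

Definition unit_normal (D : R * R -> Prop) (z n : R * R -> R4) : Prop :=
  vsmooth D n /\ forall p, D p -> normal z p (n p) /\ mink (n p) (n p) = 1.

Definition parallel_normalized_mean_curv (D : R * R -> Prop)
    (z : R * R -> R4) : Prop :=
  (forall p, D p -> mean_curv z p <> zero) /\
  ~ parallel D z (mean_curv z) /\
  exists n, unit_normal D z n /\
    (forall p, D p -> exists c, 0 < c /\ mean_curv z p = scal c (n p)) /\
    parallel D z n.

(** * Canonical isotropic parameters *)

Definition isotropic (D : R * R -> Prop) (z : R * R -> R4)
    (f : R * R -> R) : Prop :=
  smooth D f /\
  forall p, D p -> 0 < f p /\
    metric z Du Du p = 0 /\ metric z Dv Dv p = 0 /\
    metric z Du Dv p = - (f p) ^ 2.

Definition geometric_frame (D : R * R -> Prop) (z : R * R -> R4)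
    (f : R * R -> R) (x y n1 n2 : R * R -> R4) : Prop :=
  vsmooth D x /\ vsmooth D y /\ unit_normal D z n1 /\ unit_normal D z n2 /\
  forall p, D p ->
    pseudo_orthonormal (x p) (y p) (n1 p) (n2 p) /\
    x p = scal (/ f p) (vpd Du z p) /\
    y p = scal (/ f p) (vpd Dv z p) /\
    exists c, mean_curv z p = scal c (n1 p).

(** Isotropic parameters with metric function [f] are canonical with respect to
the geometric frame field [x, y, n1, n2], with geometric functions
[la], [mu], [nu]. *)
Definition canonical_wrt (D : R * R -> Prop) (z : R * R -> R4)
    (f : R * R -> R) (x y n1 n2 : R * R -> R4)
    (la mu nu : R * R -> R) : Prop :=
  isotropic D z f /\
  geometric_frame D z f x y n1 n2 /\
  forall p, D p ->
    sigma z x x p = plus (scal (la p) (n1 p)) (scal (mu p) (n2 p)) /\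
    sigma z x y p = scal (- nu p) (n1 p) /\
    sigma z y y p = zero /\
    mu p <> 0 /\
    f p = 1 / sqrt (Rabs (mu p)).

Definition canonical (D : R * R -> Prop) (z : R * R -> R4) : Prop :=
  exists f x y n1 n2 la mu nu, canonical_wrt D z f x y n1 n2 la mu nu.

(* Main.v *)
Require Import Defs.
From Stdlib Require Import Lra Classical ClassicalEpsilon.
From Stdlib Require Import FunctionalExtensionality PropExtensionality.
Set Bullet Behavior "Strict Subproofs".

(** With respect to a geometric frame, the Gauss and Weingarten formulas of a
solution are a linear first-order system for the position vector and the frame
({z, x, y, n1, n2} in [structure_eqs]), whose coefficients are made of
f = 1 / sqrt |mu|, g = ln f, la, mu, nu.  It acts separately on each of the four
coordinates of Minkowski space.  Conversely an integral frame of this system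
that starts pseudo-orthonormal yields a solution.  So the theorem is existence
and uniqueness for this system.

Local existence needs no Frobenius theorem and no smooth dependence of
solutions on parameters, because the v-dependence integrates explicitly.  Since
y_v = g_v y and n2_v = 0, the vectors Y = y / f and N = n2 depend on u only.
The Gauss equation says that h = -2 g_u / nu satisfies h_v = - f^2 nu; with it
n1 = h Y + M, f x = h^2/2 Y + h M + L and z = - (h / nu) Y + Z, where M, L, Z
depend on u only.  What is left is
  Y' = - nu M,  M' = - nu L + k Y,  L' = k M + e N,  N' = e Y,  Z' = L + r Y,
and by the compatibility equations the coefficients k, e, r depend on u only.
This ordinary system is solved by Picard iteration ([picard],
[local_solution]).

The quadratic form - 2 x y + n1^2 + n2^2 in which the system is skew gives the
rest.  Its polarisation is constant along a pair of solutions ([pairing_constant],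
[tensor_constant]).  Applied to one frame field, this propagates the
completeness relation of the frame, which is equivalent to
pseudo-orthonormality ([expansion_pseudo_orthonormal]).  Applied to two frame
fields with the same initial value, it shows that they coincide
([integral_frame_unique]).

The domain D0 cannot be a small neighbourhood of the initial point: nu may be
constant near it, and then H would be parallel.  D0 has to reach a point where
nu_u does not vanish, while D need not be simply connected.  Therefore D0 is the
union of a simple chain of small squares, in which each square meets only its
neighbours; the local solutions are glued one after the other along the chain
([chain_reaches], [chain_integral]).

That the integral frame gives a solution is the computation of the extrinsic
invariants in a null frame ([frame_canonical], [frame_gauss],
[frame_parallel_normalized]); that every solution comes from an integral frame
is [recover_frame_eqs]. *)

(** * Partial derivatives and smoothness *)

Definition axis (i : dir) (p : R * R) (t : R) : R * R :=
  match i with Du => (t, snd p) | Dv => (fst p, t) end.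

Definition abscissa (i : dir) (p : R * R) : R :=
  match i with Du => fst p | Dv => snd p end.

(** The relational form of [pd]: unlike [pd] it carries the existence of the
derivative, so that the rules below compose without side conditions. *)
Definition is_pd (i : dir) (f : R * R -> R) (p : R * R) (l : R) : Prop :=
  is_derive (fun t => f (axis i p t)) (abscissa i p) l.

Lemma axis_abscissa i p : axis i p (abscissa i p) = p.
Proof. now destruct i, p. Qed.

Lemma continuous_axis i p t : continuous (axis i p) t.
Proof.
intros P [d Hd]; exists d; intros s Hs; apply Hd.
destruct i; split; first [exact Hs | apply ball_center].
Qed.

Lemma locally_axis i p (P : R * R -> Prop) :
  locally p P -> locally (abscissa i p) (fun t => P (axis i p t)).
Proof.
intros H. apply (continuous_axis i p (abscissa i p)).
now rewrite axis_abscissa.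
Qed.

Lemma is_pd_unique i f p l : is_pd i f p l -> pd i f p = l.
Proof. destruct i; apply is_derive_unique. Qed.

Lemma is_pd_ex i f p l : is_pd i f p l -> ex_pd i f p.
Proof. destruct i; intros H; now exists l. Qed.

Lemma ex_pd_correct i f p : ex_pd i f p -> is_pd i f p (pd i f p).
Proof. destruct i; apply Derive_correct. Qed.

Lemma is_pd_val i f p l l' : is_pd i f p l -> l = l' -> is_pd i f p l'.
Proof. now intros H <-. Qed.

Lemma is_pd_inj i f p l l' : is_pd i f p l -> is_pd i f p l' -> l = l'.
Proof. intros H H'; rewrite <- (is_pd_unique _ _ _ _ H); now apply is_pd_unique. Qed.

Lemma is_pd_loc i f g p l :
  locally p (fun q => f q = g q) -> is_pd i f p l -> is_pd i g p l.
Proof.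
intros H; apply is_derive_ext_loc. exact (locally_axis i p _ H).
Qed.

Lemma is_pd_on i (D : R * R -> Prop) f g p l : open D -> D p ->
  (forall q, D q -> f q = g q) -> is_pd i f p l -> is_pd i g p l.
Proof.
intros oD Dp H; apply is_pd_loc. generalize (oD p Dp); apply filter_imp; exact H.
Qed.

Lemma is_pd_const i c p : is_pd i (fun _ => c) p 0.
Proof. exact (@is_derive_const R_AbsRing R_NormedModule c (abscissa i p)). Qed.

Lemma is_pd_plus i f g p l m :
  is_pd i f p l -> is_pd i g p m -> is_pd i (fun q => f q + g q) p (l + m).
Proof. exact (@is_derive_plus R_AbsRing R_NormedModule _ _ _ _ _). Qed.

Lemma is_pd_opp i f p l : is_pd i f p l -> is_pd i (fun q => - f q) p (- l).
Proof. exact (@is_derive_opp R_AbsRing R_NormedModule _ _ _). Qed.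

Lemma is_pd_minus i f g p l m :
  is_pd i f p l -> is_pd i g p m -> is_pd i (fun q => f q - g q) p (l - m).
Proof. exact (@is_derive_minus R_AbsRing R_NormedModule _ _ _ _ _). Qed.

Lemma is_pd_mult i f g p l m : is_pd i f p l -> is_pd i g p m ->
  is_pd i (fun q => f q * g q) p (l * g p + f p * m).
Proof.
intros H H'.
generalize (is_derive_mult _ _ _ _ _ H H' Rmult_comm).
now rewrite !axis_abscissa.
Qed.

Lemma is_pd_comp i (f : R -> R) g p l m :
  is_derive f (g p) l -> is_pd i g p m -> is_pd i (fun q => f (g q)) p (l * m).
Proof.
intros H H'. rewrite Rmult_comm.
apply (is_derive_comp f (fun t => g (axis i p t))); auto.
now rewrite axis_abscissa.
Qed.

Lemma is_pd_inv i g p m : g p <> 0 -> is_pd i g p m ->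
  is_pd i (fun q => / g q) p (- (/ g p * / g p) * m).
Proof.
intros H H'. apply (is_pd_comp i Rinv); trivial. auto_derive; trivial. now field.
Qed.

Lemma is_pd_div i f g p l m : g p <> 0 -> is_pd i f p l -> is_pd i g p m ->
  is_pd i (fun q => f q / g q) p ((l - f p / g p * m) / g p).
Proof.
intros Hg H H'. eapply is_pd_val.
apply is_pd_mult; [exact H | apply is_pd_inv; eassumption].
cbv beta; now field.
Qed.

Lemma is_pd_pow2 i f p l :
  is_pd i f p l -> is_pd i (fun q => f q ^ 2) p (2 * f p * l).
Proof.
intros H. eapply is_pd_val. apply (is_pd_comp i (fun t => t ^ 2)); eauto.
auto_derive; trivial. ring.
Qed.

Ltac pd_rule :=
  lazymatch goal with
  | H : is_pd ?i ?f ?p _ |- is_pd ?i ?f ?p _ => exact H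
  | H : is_pd ?i ?f ?p _ |- is_pd ?i (fun q => ?f q) ?p _ => exact H
  | |- is_pd _ (fun q => _ + _) _ _ => apply is_pd_plus
  | |- is_pd _ (fun q => _ - _) _ _ => apply is_pd_minus
  | |- is_pd _ (fun q => - _) _ _ => apply is_pd_opp
  | |- is_pd _ (fun q => _ * _) _ _ => apply is_pd_mult
  | |- is_pd _ (fun q => _ / _) _ _ => apply is_pd_div
  | |- is_pd _ (fun q => / _) _ _ => apply is_pd_inv
  | |- is_pd _ (fun q => _ ^ 2) _ _ => apply is_pd_pow2
  | |- is_pd _ (fun q => ?c) _ _ => apply is_pd_const
  end.

(** Differentiates a rational expression in functions whose partial
derivatives are in the context or found by [tac]; the side conditions that
[tac] does not solve and the equality of values are left over. *)
Ltac pd_solve tac := eapply is_pd_val; [repeat first [pd_rule | tac] | cbv beta].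

Lemma continuous_Rplus {U : UniformSpace} (f g : U -> R) p :
  continuous f p -> continuous g p -> continuous (fun q => f q + g q) p.
Proof. exact (@continuous_plus _ R_AbsRing R_NormedModule f g p). Qed.

Lemma continuous_Ropp {U : UniformSpace} (f : U -> R) p :
  continuous f p -> continuous (fun q => - f q) p.
Proof. exact (@continuous_opp _ R_AbsRing R_NormedModule f p). Qed.

Lemma continuous_Rminus {U : UniformSpace} (f g : U -> R) p :
  continuous f p -> continuous g p -> continuous (fun q => f q - g q) p.
Proof. exact (@continuous_minus _ R_AbsRing R_NormedModule f g p). Qed.

Lemma continuous_Rmult {U : UniformSpace} (f g : U -> R) p :
  continuous f p -> continuous g p -> continuous (fun q => f q * g q) p.
Proof. exact (@continuous_mult _ R_AbsRing f g p). Qed.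

Lemma continuous_Rinv {U : UniformSpace} (f : U -> R) p :
  f p <> 0 -> continuous f p -> continuous (fun q => / f q) p.
Proof.
intros H H'. apply (continuous_comp f Rinv); trivial.
now apply continuous_Rinv.
Qed.

Lemma continuous_on (D : R * R -> Prop) (f g : R * R -> R) p :
  open D -> D p -> (forall q, D q -> f q = g q) -> continuous f p -> continuous g p.
Proof.
intros oD Dp H; apply continuous_ext_loc.
generalize (oD p Dp); apply filter_imp; exact H.
Qed.

Lemma smooth_continuous D f p : smooth D f -> D p -> continuous f p.
Proof. intros H Dp; exact (proj1 (H nil p Dp)). Qed.

Lemma smooth_is_pd D f i p : smooth D f -> D p -> is_pd i f p (pd i f p).
Proof. intros H Dp; exact (ex_pd_correct _ _ _ (proj2 (H nil p Dp) i)). Qed.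

Lemma smooth_pd D f i : smooth D f -> smooth D (pd i f).
Proof.
intros H l. generalize (H (l ++ i :: nil)). unfold iter_pd.
now rewrite fold_right_app.
Qed.

Lemma smooth_sub (D D' : R * R -> Prop) f :
  (forall p, D' p -> D p) -> smooth D f -> smooth D' f.
Proof. intros S H l p Dp; apply H; auto. Qed.

(** A set of functions stable under partial differentiation, up to equality on
[D], consists of smooth functions.  This is the only induction over iterated
derivatives; every concrete smoothness claim is an instance. *)
Lemma smooth_coind D (S : (R * R -> R) -> Prop) : open D ->
  (forall f, S f -> (forall p, D p -> continuous f p) /\
     forall i, exists g, S g /\ forall p, D p -> is_pd i f p (g p)) ->
  forall f, S f -> smooth D f.
Proof.
intros oD HS f Sf.
assert (H : forall l, exists g, S g /\ forall p, D p -> iter_pd l f p = g p).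
{ induction l as [|i l IH]; simpl; [now exists f|].
  destruct IH as [g [Sg Hg]]. destruct (proj2 (HS g Sg) i) as [k [Sk Hk]].
  exists k; split; trivial. intros p Dp. apply is_pd_unique.
  apply (is_pd_on i D g); auto. intros q Dq; symmetry; auto. }
intros l p Dp. destruct (H l) as [g [Sg Hg]]. destruct (HS g Sg) as [Hc Hd].
split.
- apply (continuous_on D g); auto. intros q Dq; symmetry; auto.
- intros i. destruct (Hd i) as [k [_ Hk]]. apply is_pd_ex with (k p).
  apply (is_pd_on i D g); auto. intros q Dq; symmetry; auto.
Qed.

(** The algebra generated by the smooth functions and the functions in [X]. *)
Inductive alg (D : R * R -> Prop) (X : (R * R -> R) -> Prop) : (R * R -> R) -> Prop :=
| alg_smooth f : smooth D f -> alg D X f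
| alg_gen f : X f -> alg D X f
| alg_plus f g : alg D X f -> alg D X g -> alg D X (fun p => f p + g p)
| alg_mult f g : alg D X f -> alg D X g -> alg D X (fun p => f p * g p).

(** If the generators are continuous and their derivatives stay in the algebra
that they generate, the Leibniz rule makes the whole algebra stable, and
[smooth_coind] applies.  The solutions of a linear differential system with
smooth coefficients are generators of this kind. *)
Lemma smooth_alg D (X : (R * R -> R) -> Prop) : open D ->
  (forall f, X f -> (forall p, D p -> continuous f p) /\
     forall i, exists g, alg D X g /\ forall p, D p -> is_pd i f p (g p)) ->
  forall f, alg D X f -> smooth D f.
Proof.
intros oD HX. apply smooth_coind; trivial.
induction 1 as [f Hf|f Hf|f g Hf [cf df] Hg [cg dg]|f g Hf [cf df] Hg [cg dg]].
- split; [intros p; now apply smooth_continuous|].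
  intros i; exists (pd i f); split.
  now apply alg_smooth, smooth_pd. intros p Dp; now apply smooth_is_pd with D.
- auto.
- split; [intros p Dp; apply continuous_Rplus; auto|].
  intros i. destruct (df i) as [f' [Af Hf']]. destruct (dg i) as [g' [Ag Hg']].
  exists (fun p => f' p + g' p); split; [now apply alg_plus|].
  intros p Dp; apply is_pd_plus; auto.
- split; [intros p Dp; apply continuous_Rmult; auto|].
  intros i. destruct (df i) as [f' [Af Hf']]. destruct (dg i) as [g' [Ag Hg']].
  exists (fun p => f' p * g p + f p * g' p); split.
  apply alg_plus; now apply alg_mult.
  intros p Dp; apply is_pd_mult; auto.
Qed.

Lemma smooth_const D c : open D -> smooth D (fun _ => c).
Proof.
intros oD. apply (smooth_coind D (fun f => exists c, f = fun _ => c)); eauto.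
intros f [d ->]; split; [intros; apply continuous_const|].
intros i; exists (fun _ => 0); split; eauto. intros; apply is_pd_const.
Qed.

Lemma smooth_plus D f g : open D -> smooth D f -> smooth D g ->
  smooth D (fun p => f p + g p).
Proof.
intros oD Hf Hg. apply (smooth_alg D (fun _ => False)); trivial; [easy|].
now apply alg_plus; apply alg_smooth.
Qed.

Lemma smooth_mult D f g : open D -> smooth D f -> smooth D g ->
  smooth D (fun p => f p * g p).
Proof.
intros oD Hf Hg. apply (smooth_alg D (fun _ => False)); trivial; [easy|].
now apply alg_mult; apply alg_smooth.
Qed.

Lemma smooth_opp D f : open D -> smooth D f -> smooth D (fun p => - f p).
Proof.
intros oD Hf.
replace (fun p => - f p) with (fun p => (-1) * f p).
- apply smooth_mult; trivial. now apply smooth_const.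
- apply functional_extensionality; intros; ring.
Qed.

Lemma smooth_minus D f g : open D -> smooth D f -> smooth D g ->
  smooth D (fun p => f p - g p).
Proof. intros oD Hf Hg. apply smooth_plus; trivial. now apply smooth_opp. Qed.

Lemma smooth_inv D f : open D -> smooth D f -> (forall p, D p -> f p <> 0) ->
  smooth D (fun p => / f p).
Proof.
intros oD Hf H0. set (X := fun k : R * R -> R => k = fun p => / f p).
apply (smooth_alg D X); trivial; [|now apply alg_gen].
intros k ->; split.
- intros p Dp. apply continuous_Rinv; auto. now apply smooth_continuous with D.
- intros i. exists (fun p => ((/ f p * / f p) * (- pd i f p))); split.
  + apply (alg_mult D X); [apply alg_mult; now apply alg_gen|].
    now apply alg_smooth, smooth_opp, smooth_pd.
  + intros p Dp. eapply is_pd_val.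
      apply is_pd_inv; [auto|now apply smooth_is_pd with D]. ring.
Qed.

Lemma smooth_div D f g : open D -> smooth D f -> smooth D g ->
  (forall p, D p -> g p <> 0) -> smooth D (fun p => f p / g p).
Proof. intros oD Hf Hg H0. apply smooth_mult; trivial. now apply smooth_inv. Qed.

Lemma smooth_pow2 D f : open D -> smooth D f -> smooth D (fun p => f p ^ 2).
Proof.
intros oD Hf.
replace (fun p => f p ^ 2) with (fun p => f p * f p).
- now apply smooth_mult.
- apply functional_extensionality; intros; ring.
Qed.

Lemma smooth_exp D f : open D -> smooth D f -> smooth D (fun p => exp (f p)).
Proof.
intros oD Hf. set (X := fun k : R * R -> R => k = fun p => exp (f p)).
apply (smooth_alg D X); trivial; [|now apply alg_gen].
intros k ->; split.
- intros p Dp. apply (continuous_comp f exp).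
  now apply smooth_continuous with D. apply continuous_exp.
- intros i. exists (fun p => exp (f p) * pd i f p); split.
  + apply (alg_mult D X); [now apply alg_gen|now apply alg_smooth, smooth_pd].
  + intros p Dp. apply is_pd_comp; [apply is_derive_exp|].
    now apply smooth_is_pd with D.
Qed.

Lemma smooth_on D f g : open D -> (forall p, D p -> f p = g p) ->
  smooth D f -> smooth D g.
Proof.
intros oD E Hf.
apply (smooth_coind D (fun k => exists f, smooth D f /\ forall p, D p -> f p = k p)); eauto.
intros k [f' [Hf' E']]; split.
- intros p Dp; apply (continuous_on D f'); auto. now apply smooth_continuous with D.
- intros i; exists (pd i f'); split.
  + exists (pd i f'); split; trivial. now apply smooth_pd.
  + intros p Dp; apply (is_pd_on i D f'); auto. now apply smooth_is_pd with D.
Qed.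

Lemma is_derive_ln_abs t : t <> 0 -> is_derive (fun s => ln (Rabs s)) t (/ t).
Proof.
intros H. eapply is_derive_ext_loc with (f := fun s => ln (sign t * s)).
- assert (Hc : locally t (fun s => 0 < sign t * s)).
  { apply (continuous_comp (fun s => sign t * s) (fun s => s) t).
    - apply (@continuous_mult _ R_AbsRing); [apply continuous_const|apply continuous_id].
    - apply continuous_id.
    - apply open_gt. destruct (Rdichotomy _ _ H).
      rewrite sign_eq_m1; lra. rewrite sign_eq_1; lra. }
  generalize Hc; apply filter_imp; intros s Hs. f_equal.
  destruct (Rdichotomy _ _ H) as [Ht|Ht].
  + rewrite sign_eq_m1 in * by trivial. rewrite Rabs_left; lra.
  + rewrite sign_eq_1 in * by trivial. rewrite Rabs_right; lra.
- destruct (Rdichotomy _ _ H) as [Ht|Ht].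
  + rewrite sign_eq_m1 by trivial. auto_derive; [lra|now field].
  + rewrite sign_eq_1 by lra. auto_derive; [lra|now field].
Qed.

Lemma is_pd_ln_abs D f i p : smooth D f -> D p -> f p <> 0 ->
  is_pd i (fun q => ln (Rabs (f q))) p (pd i f p / f p).
Proof.
intros Hf Dp H. eapply is_pd_val.
- apply (is_pd_comp i (fun s => ln (Rabs s))).
  now apply is_derive_ln_abs. now apply smooth_is_pd with D.
- now field.
Qed.

Lemma smooth_ln_abs D f : open D -> smooth D f -> (forall p, D p -> f p <> 0) ->
  smooth D (fun p => ln (Rabs (f p))).
Proof.
intros oD Hf H0.
set (X := fun k : R * R -> R => k = fun p => ln (Rabs (f p))).
apply (smooth_alg D X); trivial; [|now apply alg_gen].
intros k ->; split.
- intros p Dp. apply (continuous_comp f (fun s => ln (Rabs s))).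
  now apply smooth_continuous with D.
  apply (@ex_derive_continuous R_AbsRing R_NormedModule).
  eexists; apply is_derive_ln_abs; auto.
- intros i. exists (fun p => pd i f p / f p); split.
  + apply alg_smooth, smooth_div; trivial. now apply smooth_pd.
  + intros p Dp. apply is_pd_ln_abs with D; auto.
Qed.

Lemma locally_locally_2d (P : R * R -> Prop) p :
  locally p P -> locally_2d (fun u v => P (u, v)) (fst p) (snd p).
Proof.
intros [d Hd]. exists d. intros u v Hu Hv. apply Hd. now split.
Qed.

Lemma pd_comm D f p : open D -> smooth D f -> D p ->
  pd Dv (pd Du f) p = pd Du (pd Dv f) p.
Proof.
intros oD Hf Dp. symmetry. destruct p as [u v].
apply (Schwarz (fun u v => f (u, v)) u v).
- generalize (locally_locally_2d D (u, v) (oD _ Dp)); apply locally_2d_impl.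
  apply locally_2d_forall. intros a b Dab. repeat split.
  + exact (proj2 (Hf nil (a, b) Dab) Du).
  + exact (proj2 (Hf nil (a, b) Dab) Dv).
  + exact (proj2 (Hf (Dv :: nil) (a, b) Dab) Du).
  + exact (proj2 (Hf (Du :: nil) (a, b) Dab) Dv).
- apply continuity_2d_pt_filterlim.
  exact (proj1 (Hf (Du :: Dv :: nil) (u, v) Dp)).
- apply continuity_2d_pt_filterlim.
  exact (proj1 (Hf (Dv :: Du :: nil) (u, v) Dp)).
Qed.

(** * Connectedness and simple chains *)

Lemma is_derive_0_const (f : R -> R) a b :
  (forall t, Rmin a b <= t <= Rmax a b -> is_derive f t 0) -> f a = f b.
Proof.
intros H. destruct (Rtotal_order a b) as [L|[->|L]]; trivial.
- apply (eq_is_derive f); trivial. intros t Ht; apply H.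
  rewrite Rmin_left, Rmax_right; lra.
- symmetry. apply (eq_is_derive f); trivial. intros t Ht; apply H.
  rewrite Rmin_right, Rmax_left; lra.
Qed.

(** Any two points are joined inside the set by a segment of each axis, which is
the form of connectedness that partial derivatives detect, and the property
passes to intersections. *)
Definition rectangular (S : R * R -> Prop) : Prop :=
  forall p q, S p -> S q -> forall u v,
    Rmin (fst p) (fst q) <= u <= Rmax (fst p) (fst q) ->
    Rmin (snd p) (snd q) <= v <= Rmax (snd p) (snd q) -> S (u, v).

Lemma Rmin_Rmax_ball (c d a b t : R) : ball c d a -> ball c d b ->
  Rmin a b <= t <= Rmax a b -> ball c d t.
Proof.
unfold ball; simpl; unfold AbsRing_ball, abs, minus, plus, opp; simpl.
unfold Rmin, Rmax; intros H1 H2 H3; apply Rabs_def2 in H1; apply Rabs_def2 in H2.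
apply Rabs_def1; destruct (Rle_dec a b); lra.
Qed.

Lemma rectangular_ball (p : R * R) d : rectangular (ball p d).
Proof.
intros q r [Hq Hq'] [Hr Hr'] u v Hu Hv; split.
now apply Rmin_Rmax_ball with (fst q) (fst r).
now apply Rmin_Rmax_ball with (snd q) (snd r).
Qed.

Lemma rectangular_and S S' : rectangular S -> rectangular S' ->
  rectangular (fun p => S p /\ S' p).
Proof.
intros H H' p q [Sp Sp'] [Sq Sq'] u v Hu Hv; split.
now apply (H p q). now apply (H' p q).
Qed.

Lemma rectangular_constant_v S F : rectangular S ->
  (forall p, S p -> is_pd Dv F p 0) ->
  forall p q, S p -> S q -> F (fst p, snd p) = F (fst p, snd q).
Proof.
intros HS HF p q Sp Sq.
apply (is_derive_0_const (fun t => F (fst p, t))). intros t Ht.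
apply (HF (fst p, t)). apply (HS p q); trivial.
split; [apply Rmin_l|apply Rmax_l].
Qed.

Lemma rectangular_constant S F : rectangular S ->
  (forall i p, S p -> is_pd i F p 0) -> forall p q, S p -> S q -> F p = F q.
Proof.
intros HS HF p q Sp Sq.
rewrite (surjective_pairing p), (rectangular_constant_v S F HS (HF Dv) p q Sp Sq).
rewrite (surjective_pairing q).
apply (is_derive_0_const (fun t => F (t, snd q))). intros t Ht.
apply (HF Du (t, snd q)). apply (HS p q); trivial.
split; [apply Rmin_r|apply Rmax_r].
Qed.

Lemma rectangular_domain S :
  open S -> (exists p, S p) -> rectangular S -> domain S.
Proof.
intros oS nS HS; split; [trivial|split; trivial].
intros A B oA oB cover [p [Sp Ap]] [q [Sq Bq]].
apply NNPP; intros nAB.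
(* The indicator function of A is locally constant on S. *)
set (F := fun r => if excluded_middle_informative (A r) then 1 else 0).
assert (HF : forall i r, S r -> is_pd i F r 0).
{ intros i r Sr. destruct (cover r Sr) as [Ar|Br].
  - apply is_pd_loc with (fun _ => 1); [|apply is_pd_const].
    generalize (oA r Ar); apply filter_imp. intros s As; unfold F.
    now destruct (excluded_middle_informative (A s)).
  - apply is_pd_loc with (fun _ => 0); [|apply is_pd_const].
    generalize (filter_and _ _ (oB r Br) (oS r Sr)); apply filter_imp.
    intros s [Bs Ss]; unfold F.
    destruct (excluded_middle_informative (A s)); trivial.
    exfalso; eauto. }
generalize (rectangular_constant S F HS HF p q Sp Sq). unfold F.
destruct (excluded_middle_informative (A p)); [|easy].
destruct (excluded_middle_informative (A q)); [exfalso; eauto|lra].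
Qed.

(** The set where [F] takes its value at [p] and its complement are both open. *)
Lemma domain_constant D F : domain D -> (forall i p, D p -> is_pd i F p 0) ->
  forall p q, D p -> D q -> F p = F q.
Proof.
intros [oD [_ cD]] HF p q Dp Dq. apply NNPP; intros n.
assert (loc : forall r, D r -> locally r (fun s => D s /\ F s = F r)).
{ intros r Dr. destruct (oD r Dr) as [d Hd]. exists d. intros s Hs; split; auto.
  apply (rectangular_constant (ball r d)); auto using ball_center.
  apply rectangular_ball. }
destruct (cD (fun r => D r /\ F r = F p) (fun r => D r /\ F r <> F p))
  as [r [_ [[_ H] [_ H']]]]; eauto.
- intros r [Dr <-]; now apply loc.
- intros r [Dr H]; generalize (loc r Dr); apply filter_imp.
  intros s [Ds ->]; auto.
- intros r Dr. destruct (classic (F r = F p)); auto.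
Qed.

Lemma domain_positive D F : domain D ->
  (forall p, D p -> continuous F p) -> (forall p, D p -> F p <> 0) ->
  forall p q, D p -> D q -> 0 < F p -> 0 < F q.
Proof.
intros [oD [_ cD]] cF H0 p q Dp Dq Fp. apply NNPP; intros Fq.
destruct (cD (fun r => D r /\ 0 < F r) (fun r => D r /\ F r < 0))
  as [r [_ [[_ H] [_ H']]]]; try lra.
- intros r [Dr Hr]. apply filter_and; auto.
  apply (cF r Dr (fun t => 0 < t)). now apply open_gt.
- intros r [Dr Hr]. apply filter_and; auto.
  apply (cF r Dr (fun t => t < 0)). now apply open_lt.
- intros r Dr. destruct (Rdichotomy _ _ (H0 r Dr)); auto.
- exists p; auto.
- exists q; repeat split; trivial. destruct (Rdichotomy _ _ (H0 q Dq)); lra.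
Qed.

Definition union (U V : R * R -> Prop) : R * R -> Prop := fun p => U p \/ V p.

Lemma domain_union U V : domain U -> domain V -> (exists p, U p /\ V p) ->
  domain (union U V).
Proof.
intros [oU [nU cU]] [oV [nV cV]] [c [Uc Vc]]; split; [|split].
- intros p [Up|Vp]; [generalize (oU p Up)|generalize (oV p Vp)];
  apply filter_imp; unfold union; auto.
- exists c; now left.
- intros A B oA oB cover [p [Hp Ap]] [q [Hq Bq]].
  apply NNPP; intros n.
  assert (nU' : (exists p, U p /\ A p) -> (exists p, U p /\ B p) -> False).
  { intros HA HB. destruct (cU A B oA oB) as [r [Ur ABr]]; trivial.
    intros r Ur; apply cover; now left. apply n; exists r; split; trivial; now left. }
  assert (nV' : (exists p, V p /\ A p) -> (exists p, V p /\ B p) -> False).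
  { intros HA HB. destruct (cV A B oA oB) as [r [Vr ABr]]; trivial.
    intros r Vr; apply cover; now right. apply n; exists r; split; trivial; now right. }
  destruct (cover c (or_introl Uc)) as [Ac|Bc].
  + destruct Hq; [apply nU'|apply nV']; eauto.
  + destruct Hp; [apply nU'|apply nV']; eauto.
Qed.

(** [chain good p U Q]: a finite sequence of [good] sets starts at one that
contains [p] and ends with [Q]; [U] is the union of the sets before [Q].  Each
set meets its predecessor and no earlier set, so that [Q] meets [U] inside a
single member of the sequence. *)
Inductive chain (good : (R * R -> Prop) -> Prop) (p : R * R) :
  (R * R -> Prop) -> (R * R -> Prop) -> Prop :=
| chain_one Q : good Q -> Q p -> chain good p (fun _ => False) Q
| chain_next U Q Q' : chain good p U Q -> good Q' ->
    (exists q, Q q /\ Q' q) -> (forall q, U q -> ~ Q' q) ->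
    chain good p (union U Q) Q'.

(** Cut the chain after the first member that meets [Q']. *)
Lemma chain_extend good p U Q Q' : chain good p U Q -> good Q' ->
  (exists q, union U Q q /\ Q' q) -> exists U', chain good p U' Q'.
Proof.
intros C gQ'. induction C as [Q gQ Qp|U Q Q1 C IH gQ1 meet away].
- intros [q [[[]|Qq] Q'q]]. eexists; apply (chain_next good p (fun _ => False) Q).
  apply chain_one; eauto. trivial. eauto. easy.
- intros [q [Hq Q'q]].
  destruct (classic (exists q, union U Q q /\ Q' q)) as [H|H]; [now apply IH|].
  exists (union (union U Q) Q1). apply chain_next; trivial.
  + now apply chain_next.
  + destruct Hq; [exfalso|]; eauto.
  + intros r Hr Q'r; eauto.
Qed.

(** The points reached by chains form an open set, and so do the others: a good
set around a limit of reached points extends a chain. *)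
Lemma chain_reaches D good : domain D ->
  (forall Q, good Q -> open Q) ->
  (forall p, D p -> exists Q, good Q /\ Q p) ->
  forall p q, D p -> D q -> exists U Q, chain good p U Q /\ Q q.
Proof.
intros [oD [_ cD]] oG cover p q Dp Dq.
set (S := fun r => exists U Q, chain good p U Q /\ Q r).
assert (gS : forall U Q, chain good p U Q -> good Q) by (now destruct 1).
assert (US : forall U Q, chain good p U Q -> forall r, union U Q r -> S r).
{ induction 1 as [Q gQ Qp|U Q Q1 C IH gQ1 meet away]; intros r [Hr|Hr]; try easy.
  - exists (fun _ => False), Q; split; trivial. now apply chain_one.
  - now apply IH.
  - exists (union U Q), Q1; split; trivial. now apply chain_next. }
apply NNPP; intros nq.
destruct (cD S (fun r => D r /\ ~ S r)) as [r [_ [H [_ H']]]]; try easy.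
- intros r [U [Q [C Qr]]]. generalize (oG Q (gS U Q C) r Qr).
  apply filter_imp. intros s Qs; now exists U, Q.
- intros r [Dr nr]. destruct (cover r Dr) as [Q [gQ Qr]].
  generalize (filter_and _ _ (oD r Dr) (oG Q gQ r Qr)); apply filter_imp.
  intros s [Ds Qs]; split; trivial. intros [U [Q1 [C Q1s]]]. apply nr.
  destruct (chain_extend good p U Q1 Q C gQ) as [U' C'].
  { exists s; split; trivial. now right. }
  now exists U', Q.
- intros r Dr. destruct (classic (S r)); auto.
- exists p; split; trivial. destruct (cover p Dp) as [Q [gQ Qp]].
  exists (fun _ => False), Q; split; trivial. now apply chain_one.
- exists q; split; [trivial|split; trivial].
Qed.

Lemma chain_in good p U Q : chain good p U Q -> union U Q p.
Proof. induction 1; [now right|now left]. Qed.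

Lemma chain_sub (D : R * R -> Prop) good p U Q :
  (forall Q, good Q -> forall q, Q q -> D q) ->
  chain good p U Q -> forall q, union U Q q -> D q.
Proof.
intros gD. induction 1 as [Q gQ Qp|U Q Q1 C IH gQ1 meet away];
intros q [H|H]; try easy; eauto.
Qed.

Lemma chain_domain good p U Q : (forall Q, good Q -> domain Q) ->
  chain good p U Q -> domain (union U Q).
Proof.
intros gD. induction 1 as [Q gQ Qp|U Q Q1 C IH gQ1 [q [H H']] away].
- replace (union (fun _ => False) Q) with Q; [auto|].
  apply functional_extensionality; intros r.
  apply propositional_extensionality; unfold union; tauto.
- apply domain_union; auto. exists q; split; trivial; now right.
Qed.

(** * Local solutions of ordinary differential systems *)

Lemma half_pow_small K eps : 0 < eps -> exists n, K * (1 / 2) ^ n < eps.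
Proof.
intros He. assert (Hl : Rabs (1 / 2) < 1) by (rewrite Rabs_right; lra).
destruct (pow_lt_1_zero (1 / 2) Hl (eps / (Rabs K + 1))) as [N HN].
{ apply Rdiv_lt_0_compat; trivial. generalize (Rabs_pos K); lra. }
exists N. generalize (HN N (le_n N)); intros H.
assert (HK := Rabs_pos K).
rewrite Rabs_right in H by (apply Rle_ge, pow_le; lra).
apply (Rmult_lt_compat_r (Rabs K + 1)) in H; [|lra].
replace (eps / (Rabs K + 1) * (Rabs K + 1)) with eps in H by (field; lra).
assert (0 <= (1 / 2) ^ N) by (apply pow_le; lra).
assert (K <= Rabs K) by apply Rle_abs. nra.
Qed.

(** The limit is the supremum of the increasing minorants u_n - 2 K / 2^n, which
lie below all the decreasing majorants u_n + 2 K / 2^n. *)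
Lemma geometric_limit (u : nat -> R) K :
  (forall n, Rabs (u (S n) - u n) <= K * (1 / 2) ^ n) ->
  exists l, forall n, Rabs (l - u n) <= 2 * K * (1 / 2) ^ n.
Proof.
intros H.
set (r n := 2 * K * (1 / 2) ^ n).
assert (Hr : forall n, r (S n) = r n - K * (1 / 2) ^ n) by (intros; unfold r; simpl; field).
assert (r0 : forall n, 0 <= r n).
{ intros n. generalize (Rle_trans _ _ _ (Rabs_pos _) (H n)). unfold r; lra. }
assert (up : forall n k, u n - r n <= u (n + k)%nat - r (n + k)%nat).
{ intros n k; induction k as [|k IH]; [rewrite Nat.add_0_r; lra|].
  rewrite Nat.add_succ_r, Hr.
  destruct (proj1 (Rabs_le_between _ _) (H (n + k)%nat)); lra. }
assert (down : forall n k, u (n + k)%nat + r (n + k)%nat <= u n + r n).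
{ intros n k; induction k as [|k IH]; [rewrite Nat.add_0_r; lra|].
  rewrite Nat.add_succ_r, Hr.
  destruct (proj1 (Rabs_le_between _ _) (H (n + k)%nat)); lra. }
assert (sep : forall n m, u n - r n <= u m + r m).
{ intros n m. generalize (up n m) (down m n) (r0 (n + m)%nat).
  rewrite (Nat.add_comm m n); lra. }
destruct (completeness (fun x => exists n, x = u n - r n)) as [l [ub lub]].
- exists (u O + r O). intros x [n ->]; apply sep.
- now exists (u O - r O), O.
- exists l. intros n. fold (r n). apply Rabs_le_between. split.
  + assert (u n - r n <= l) by (apply ub; now exists n). lra.
  + assert (l <= u n + r n) by (apply lub; intros x [m ->]; apply sep). lra.
Qed.

Lemma Rabs_RInt_le (f : R -> R) M a b : (forall t, continuous f t) ->
  (forall t, Rabs (f t) <= M) -> Rabs (RInt f a b) <= Rabs (b - a) * M.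
Proof.
intros cf HM.
assert (ex : forall a b, ex_RInt f a b).
{ intros; apply (@ex_RInt_continuous R_CompleteNormedModule); auto. }
destruct (Rle_dec a b) as [L|L].
- rewrite (Rabs_right (b - a)) by lra. apply abs_RInt_le_const; auto.
- rewrite <- (opp_RInt_swap f) by auto. unfold opp; simpl. rewrite Rabs_Ropp.
  rewrite (Rabs_left (b - a)) by lra. replace (- (b - a)) with (a - b) by ring.
  apply abs_RInt_le_const; auto; lra.
Qed.

Definition clamp (a b t : R) : R := Rmax a (Rmin b t).

Lemma clamp_bounds a b t : a <= b -> a <= clamp a b t <= b.
Proof. intros H; unfold clamp, Rmax, Rmin; repeat destruct Rle_dec; lra. Qed.

Lemma clamp_id a b t : a <= t <= b -> clamp a b t = t.
Proof. intros H; unfold clamp, Rmax, Rmin; repeat destruct Rle_dec; lra. Qed.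

Lemma continuous_clamp a b t : continuous (clamp a b) t.
Proof.
apply continuity_pt_filterlim. intros e He; exists e; split; trivial.
intros s [_ Hs]; revert Hs; unfold dist; simpl; unfold Rdist.
intros Hs; apply Rabs_def2 in Hs; apply Rabs_def1;
unfold clamp, Rmax, Rmin; repeat destruct Rle_dec; lra.
Qed.

Lemma continuous_uniform_limit (w : R -> R) (W : nat -> R -> R) K :
  (forall n t, continuous (W n) t) ->
  (forall n t, Rabs (w t - W n t) <= K * (1 / 2) ^ n) ->
  forall t, continuous w t.
Proof.
intros cW HW t. apply continuity_pt_filterlim. intros e He.
destruct (half_pow_small K (e / 3)) as [n Hn]; [lra|].
destruct (proj2 (continuity_pt_filterlim (W n) t) (cW n t) (e / 3)) as [d [Hd Hc]]; [lra|].
exists d; split; trivial. intros s Hs. generalize (Hc s Hs).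
unfold dist; simpl; unfold Rdist. intros Hc'.
generalize (HW n s) (HW n t); intros H1 H2.
apply Rabs_def2 in Hc'.
apply Rabs_le_between in H1; apply Rabs_le_between in H2.
apply Rabs_def1; lra.
Qed.

(** Picard iteration on an interval so short that the integral operator is a
contraction of ratio 1/2 for the supremum over the indices and the times.  Times
are clamped to the interval from [a] to [b], which makes every function of the
iteration total, continuous and subject to uniform bounds. *)
Lemma picard (T : Type) (G : T -> R -> (T -> R) -> R) (a b C B t0 : R) (c : T -> R) :
  a <= t0 <= b -> 0 <= C -> C * (b - a) <= 1 / 2 ->
  (forall i (w : T -> R -> R), (forall j t, continuous (w j) t) ->
     forall t, a <= t <= b -> continuous (fun s => G i s (fun j => w j s)) t) ->
  (forall i t x y d, a <= t <= b -> (forall j, Rabs (x j - y j) <= d) ->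
     Rabs (G i t x - G i t y) <= C * d) ->
  (forall i t, a <= t <= b -> Rabs (G i t c) <= B) ->
  exists w : T -> R -> R, (forall i, w i t0 = c i) /\
    (forall i t, continuous (w i) t) /\
    forall i t, a < t < b -> is_derive (w i) t (G i t (fun j => w j t)).
Proof.
intros Ht0 HC HCab cG lipG bG.
set (h := fun (w : T -> R -> R) i s => G i (clamp a b s) (fun j => w j (clamp a b s))).
set (step := fun (w : T -> R -> R) i t => c i + RInt (h w i) t0 (clamp a b t)).
assert (clampab : forall t, a <= clamp a b t <= b) by (intros; apply clamp_bounds; lra).
assert (ch : forall w, (forall j t, continuous (w j) t) ->
  forall i t, continuous (h w i) t).
{ intros w cw i t.
  apply (continuous_comp (clamp a b) (fun s => G i s (fun j => w j s))).
  apply continuous_clamp. now apply cG. }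
assert (exh : forall w, (forall j t, continuous (w j) t) ->
  forall i x y, ex_RInt (h w i) x y).
{ intros; apply (@ex_RInt_continuous R_CompleteNormedModule); auto. }
assert (dint : forall w, (forall j t, continuous (w j) t) -> forall i t,
  is_derive (fun s => RInt (h w i) t0 s) t (h w i t)).
{ intros w cw i t. apply (is_derive_RInt (h w i) _ t0); auto.
  apply filter_forall; intros s. apply (@RInt_correct R_CompleteNormedModule); now apply exh. }
assert (cstep : forall w, (forall j t, continuous (w j) t) ->
  forall j t, continuous (step w j) t).
{ intros w cw j t. unfold step.
  apply (@continuous_plus _ R_AbsRing R_NormedModule); [apply continuous_const|].
  apply (continuous_comp (clamp a b) (fun s => RInt (h w j) t0 s)).
  apply continuous_clamp.
  apply (@ex_derive_continuous R_AbsRing R_NormedModule). eexists; now apply dint. }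
assert (contr : forall w w' d, (forall j t, continuous (w j) t) ->
  (forall j t, continuous (w' j) t) ->
  (forall j t, Rabs (w j t - w' j t) <= d) ->
  forall j t, Rabs (step w j t - step w' j t) <= d / 2).
{ intros w w' d cw cw' Hd j t. unfold step.
  set (I := RInt (h w j) t0 (clamp a b t)). set (I' := RInt (h w' j) t0 (clamp a b t)).
  replace (c j + I - _) with (I - I') by ring. unfold I, I'.
  change (Rabs (minus (RInt (h w j) t0 (clamp a b t))
                      (RInt (h w' j) t0 (clamp a b t))) <= d / 2).
  rewrite <- (@RInt_minus R_CompleteNormedModule) by auto.
  eapply Rle_trans; [apply (Rabs_RInt_le _ (C * d))|].
  - intros s. apply (@continuous_minus _ R_AbsRing R_NormedModule); auto.
  - intros s. apply lipG; auto.
  - assert (0 <= d) by (eapply Rle_trans; [apply Rabs_pos|apply (Hd j t)]).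
    assert (Rabs (clamp a b t - t0) <= b - a).
    { apply Rabs_le_between; generalize (clampab t); lra. }
    apply Rle_trans with ((b - a) * (C * d)).
    + apply Rmult_le_compat_r; trivial. now apply Rmult_le_pos.
    + replace ((b - a) * (C * d)) with (C * (b - a) * d) by ring. nra. }
set (W := fix W n := match n with O => fun i _ => c i | S n => step (W n) end).
assert (cW : forall n j t, continuous (W n j) t).
{ induction n as [|n IH]; simpl; intros; [apply continuous_const|now apply cstep]. }
set (K := (b - a) * Rabs B).
assert (dW : forall n j t, Rabs (W (S n) j t - W n j t) <= K * (1 / 2) ^ n).
{ induction n as [|n IH]; intros j t.
  - change (W 1%nat j t - W O j t) with (c j + RInt (h (W O) j) t0 (clamp a b t) - c j).
    rewrite Rplus_minus_l.
    change ((1 / 2) ^ 0) with 1; rewrite Rmult_1_r.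
    eapply Rle_trans; [apply (Rabs_RInt_le _ (Rabs B))|].
    + apply ch, cW.
    + intros s. eapply Rle_trans; [|apply Rle_abs]. apply bG; auto.
    + apply Rmult_le_compat_r; [apply Rabs_pos|].
      apply Rabs_le_between; generalize (clampab t); lra.
  - change (W (S (S n)) j t) with (step (W (S n)) j t).
    change (W (S n) j t) with (step (W n) j t).
    eapply Rle_trans; [apply (contr _ _ (K * (1 / 2) ^ n)); auto|]. simpl; lra. }
destruct (choice (fun (x : T * R) l =>
  forall n, Rabs (l - W n (fst x) (snd x)) <= 2 * K * (1 / 2) ^ n)) as [w Hw].
{ intros [j t]. now apply (geometric_limit (fun n => W n j t)). }
set (w' := fun j t => w (j, t)).
assert (Hw' : forall n j t, Rabs (w' j t - W n j t) <= 2 * K * (1 / 2) ^ n)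
  by (intros n j t; apply (Hw (j, t))).
assert (cw : forall j t, continuous (w' j) t).
{ intros j. apply (continuous_uniform_limit _ (fun n => W n j) (2 * K)); auto. }
assert (fixw : forall j t, w' j t = step w' j t).
{ intros j t. apply Rminus_diag_uniq. apply NNPP; intros n0.
  apply Rabs_pos_lt in n0.
  destruct (half_pow_small (4 * K) _ n0) as [n Hn].
  assert (H1 := Hw' (S n) j t).
  assert (H2 := contr (W n) w' _ (cW n) cw
    (fun j t => eq_ind_r (fun x => x <= _) (Hw' n j t) (Rabs_minus_sym _ _)) j t).
  change (W (S n) j t) with (step (W n) j t) in H1. simpl in H1.
  set (q := step (W n) j t) in *. revert Hn.
  replace (w' j t - step w' j t) with ((w' j t - q) + (q - step w' j t)) by ring.
  generalize (Rabs_triang (w' j t - q) (q - step w' j t)).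
  assert (0 <= K * (1 / 2) ^ n).
  { apply Rmult_le_pos; [apply Rmult_le_pos; [lra|apply Rabs_pos]|apply pow_le; lra]. }
  lra. }
exists w'; split; [|split; [exact cw|]].
- intros i. rewrite fixw. unfold step. rewrite clamp_id by trivial.
  rewrite RInt_point. unfold zero; simpl; ring.
- intros i t Ht.
  assert (Hv : G i t (fun j => w' j t) = 0 + h w' i t).
  { unfold h. rewrite clamp_id by lra. ring. }
  rewrite Hv.
  apply is_derive_ext_loc with (fun s => c i + RInt (h w' i) t0 s).
  + assert (L : locally t (fun s => a < s /\ s < b)).
    { apply filter_and; [apply open_gt|apply open_lt]; lra. }
    generalize L; apply filter_imp; intros s Hs. rewrite fixw.
    unfold step. now rewrite clamp_id by lra.
  + apply (@is_derive_plus R_AbsRing R_NormedModule); auto.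
    apply (@is_derive_const R_AbsRing R_NormedModule).
Qed.

(** * The structure equations in one coordinate of the ambient space *)

(** [f] is the metric function and [g] its logarithm; [mu] and [f ^ -2] agree up
to a locally constant factor, which is what [cp_dmu] expresses. *)
Record compatible (D : R * R -> Prop) (f g la mu nu : R * R -> R) : Prop := {
  cp_open : open D;
  cp_sf : smooth D f;
  cp_sg : smooth D g;
  cp_sla : smooth D la;
  cp_smu : smooth D mu;
  cp_snu : smooth D nu;
  cp_f : forall p, D p -> 0 < f p;
  cp_mu : forall p, D p -> mu p <> 0;
  cp_nu : forall p, D p -> nu p <> 0;
  cp_df : forall i p, D p -> pd i f p = f p * pd i g p;
  cp_dmu : forall i p, D p -> pd i mu p = -2 * mu p * pd i g p;
  cp_nuv : forall p, D p -> pd Dv nu p = 0;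
  cp_codazzi : forall p, D p -> pd Du nu p + pd Dv la p = -2 * la p * pd Dv g p;
  cp_gauss : forall p, D p -> 2 * pd Dv (pd Du g) p = f p ^ 2 * nu p ^ 2
}.

Arguments cp_open {D f g la mu nu}.
Arguments cp_sf {D f g la mu nu}.
Arguments cp_sg {D f g la mu nu}.
Arguments cp_sla {D f g la mu nu}.
Arguments cp_smu {D f g la mu nu}.
Arguments cp_snu {D f g la mu nu}.
Arguments cp_f {D f g la mu nu}.
Arguments cp_mu {D f g la mu nu}.
Arguments cp_nu {D f g la mu nu}.
Arguments cp_df {D f g la mu nu}.
Arguments cp_dmu {D f g la mu nu}.
Arguments cp_nuv {D f g la mu nu}.
Arguments cp_codazzi {D f g la mu nu}.
Arguments cp_gauss {D f g la mu nu}.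

(** One coordinate of the Gauss and Weingarten formulas for a position vector [z]
and a geometric frame [x], [y], [m], [n]. *)
Record structure_eqs (f g la mu nu z x y m n : R * R -> R) (p : R * R) : Prop := {
  se_zu : is_pd Du z p (f p * x p);
  se_zv : is_pd Dv z p (f p * y p);
  se_xu : is_pd Du x p (pd Du g p * x p + f p * (la p * m p + mu p * n p));
  se_xv : is_pd Dv x p (- f p * nu p * m p - pd Dv g p * x p);
  se_yu : is_pd Du y p (- f p * nu p * m p - pd Du g p * y p);
  se_yv : is_pd Dv y p (pd Dv g p * y p);
  se_mu : is_pd Du m p (- f p * nu p * x p + f p * la p * y p);
  se_mv : is_pd Dv m p (- f p * nu p * y p);
  se_nu : is_pd Du n p (f p * mu p * y p);
  se_nv : is_pd Dv n p 0
}.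

Definition integral_on (S : R * R -> Prop) (f g la mu nu z x y m n : R * R -> R) : Prop :=
  forall p, S p -> structure_eqs f g la mu nu z x y m n p /\
    continuous z p /\ continuous x p /\ continuous y p /\ continuous m p /\ continuous n p.

(** The functions of [u] alone to which the structure equations reduce. *)
Inductive unknown := UY | UM | UL | UN | UZ.

Lemma locally_Rabs_lt (F : R * R -> R) p K :
  continuous F p -> Rabs (F p) < K -> locally p (fun q => Rabs (F q) < K).
Proof.
intros cF H.
apply (continuous_comp F Rabs p cF (continuous_Rabs (F p)) (fun t => t < K)).
now apply open_lt.
Qed.

Section LocalSolution.

Variables (D : R * R -> Prop) (f g la mu nu : R * R -> R).
Hypothesis cpt : compatible D f g la mu nu.

Let oD : open D := cp_open cpt.
Let sf : smooth D f := cp_sf cpt.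
Let sg : smooth D g := cp_sg cpt.
Let sla : smooth D la := cp_sla cpt.
Let smu : smooth D mu := cp_smu cpt.
Let snu : smooth D nu := cp_snu cpt.

(** The parameter of the null rotation about [y] that removes the dependence of
the frame on [v], once [x] and [y] are rescaled by [f]. *)
Definition null_angle (p : R * R) : R := -2 * pd Du g p / nu p.
(** The coefficients that the reduced system [ode] must have; they do not depend
on [v]. *)
Definition coef_k (p : R * R) : R :=
  la p * f p ^ 2 - pd Du null_angle p - nu p * null_angle p ^ 2 / 2.
Definition coef_r (p : R * R) : R :=
  null_angle p ^ 2 / 2 + pd Du null_angle p / nu p - null_angle p * pd Du nu p / nu p ^ 2.
Definition coef_e (p : R * R) : R := f p ^ 2 * mu p.

Ltac smooth_atom := repeat apply smooth_pd; assumption.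

Ltac pd_atom := idtac;
  match goal with
  | |- is_pd ?i (fun q => ?f q) ?p _ =>
    exact (smooth_is_pd D f i p ltac:(smooth_atom) ltac:(assumption))
  | |- is_pd ?i ?f ?p _ =>
    exact (smooth_is_pd D f i p ltac:(smooth_atom) ltac:(assumption))
  | |- _ <> _ => first [assumption | apply pow_nonzero; assumption | lra]
  end.

Lemma smooth_null_angle : smooth D null_angle.
Proof.
apply smooth_div; trivial; [|apply cpt].
apply smooth_mult; trivial; [now apply smooth_const|now apply smooth_pd].
Qed.

Lemma smooth_coef_k : smooth D coef_k.
Proof.
assert (H := smooth_null_angle).
apply smooth_minus; trivial; [apply smooth_minus; trivial|].
- apply smooth_mult; trivial. now apply smooth_pow2.
- now apply smooth_pd.
- apply smooth_div; trivial; [|now apply smooth_const].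
  apply smooth_mult; trivial. now apply smooth_pow2.
Qed.

Lemma smooth_coef_r : smooth D coef_r.
Proof.
assert (H := smooth_null_angle).
apply smooth_minus; trivial; [apply smooth_plus; trivial|].
- apply smooth_div; trivial; [now apply smooth_pow2|now apply smooth_const].
- apply smooth_div; trivial; [now apply smooth_pd|apply cpt].
- apply smooth_div; trivial.
  + apply smooth_mult; trivial. now apply smooth_pd.
  + now apply smooth_pow2.
  + intros p Dp. apply pow_nonzero. now apply cpt.
Qed.

(** The Gauss equation, in the form that integrates along [v]. *)
Lemma null_angle_v p : D p -> is_pd Dv null_angle p (- f p ^ 2 * nu p).
Proof.
intros Dp. unfold null_angle. assert (H0 : nu p <> 0) by now apply cpt.
pd_solve pd_atom.
rewrite (cp_nuv cpt) by trivial.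
generalize (cp_gauss cpt p Dp); intros E.
apply (Rmult_eq_reg_r (nu p)); trivial. field_simplify; trivial. lra.
Qed.

Lemma null_angle_uv p : D p -> is_pd Dv (pd Du null_angle) p
  (- f p ^ 2 * (2 * pd Du g p * nu p + pd Du nu p)).
Proof.
intros Dp. eapply is_pd_val.
- apply smooth_is_pd with D; trivial. apply smooth_pd, smooth_null_angle.
- rewrite (pd_comm D) by first [exact oD | exact smooth_null_angle | trivial].
  apply is_pd_unique.
  apply (is_pd_on Du D (fun p => - f p ^ 2 * nu p)); trivial.
  + intros q Dq. symmetry. now apply is_pd_unique, null_angle_v.
  + pd_solve pd_atom. rewrite (cp_df cpt) by trivial. ring.
Qed.

(** This is where the Codazzi equation enters. *)
Lemma coef_k_v p : D p -> is_pd Dv coef_k p 0.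
Proof.
intros Dp. unfold coef_k.
assert (Hh := null_angle_v p Dp). assert (Hhu := null_angle_uv p Dp).
assert (H0 : nu p <> 0) by now apply cpt.
pd_solve pd_atom.
rewrite (cp_nuv cpt), (cp_df cpt) by trivial.
generalize (cp_codazzi cpt p Dp); intros E.
replace (pd Dv la p) with (-2 * la p * pd Dv g p - pd Du nu p) by lra.
unfold null_angle. now field.
Qed.

Lemma coef_r_v p : D p -> is_pd Dv coef_r p 0.
Proof.
intros Dp. unfold coef_r.
assert (Hh := null_angle_v p Dp). assert (Hhu := null_angle_uv p Dp).
assert (H0 : nu p <> 0) by now apply cpt.
assert (H1 : is_pd Dv (pd Du nu) p 0).
{ eapply is_pd_val; [pd_atom|].
  rewrite (pd_comm D) by first [exact oD | apply cpt | trivial].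
  apply is_pd_unique, (is_pd_on Du D (fun _ => 0)); trivial.
  intros q Dq; symmetry; now apply cpt. apply is_pd_const. }
pd_solve pd_atom.
rewrite (cp_nuv cpt) by trivial.
unfold null_angle. now field.
Qed.

Lemma coef_e_constant i p : D p -> is_pd i coef_e p 0.
Proof.
intros Dp. unfold coef_e. pd_solve pd_atom.
rewrite (cp_df cpt), (cp_dmu cpt) by trivial. ring.
Qed.

Definition ode (q : R * R) (i : unknown) (t : R) (w : unknown -> R) : R :=
  match i with
  | UY => - nu (axis Du q t) * w UM
  | UM => - nu (axis Du q t) * w UL + coef_k (axis Du q t) * w UY
  | UL => coef_k (axis Du q t) * w UM + coef_e q * w UN
  | UN => coef_e q * w UY
  | UZ => w UL + coef_r (axis Du q t) * w UY
  end.

Lemma ode_lipschitz q i t x y K d : 1 <= K ->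
  Rabs (nu (axis Du q t)) <= K -> Rabs (coef_k (axis Du q t)) <= K ->
  Rabs (coef_r (axis Du q t)) <= K -> Rabs (coef_e q) <= K ->
  (forall j, Rabs (x j - y j) <= d) ->
  Rabs (ode q i t x - ode q i t y) <= 2 * K * d.
Proof.
intros K1 Hn Hk Hr He Hd.
assert (d0 : 0 <= d) by (eapply Rle_trans; [apply Rabs_pos|apply (Hd UY)]).
assert (H : forall c j, Rabs c <= K -> Rabs (c * (x j - y j)) <= K * d).
{ intros c j Hc. rewrite Rabs_mult. apply Rmult_le_compat; auto; apply Rabs_pos. }
assert (HKd : 0 <= K * d) by (apply Rmult_le_pos; lra).
destruct i; unfold ode.
- replace (_ - _) with (- (nu (axis Du q t) * (x UM - y UM))) by ring.
  rewrite Rabs_Ropp. generalize (H _ UM Hn); lra.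
- replace (_ - _) with
    (- (nu (axis Du q t) * (x UL - y UL)) + coef_k (axis Du q t) * (x UY - y UY)) by ring.
  eapply Rle_trans; [apply Rabs_triang|]. rewrite Rabs_Ropp.
  generalize (H _ UL Hn) (H _ UY Hk); lra.
- replace (_ - _) with (coef_k (axis Du q t) * (x UM - y UM) + coef_e q * (x UN - y UN)) by ring.
  eapply Rle_trans; [apply Rabs_triang|].
  generalize (H _ UM Hk) (H _ UN He); lra.
- replace (_ - _) with (coef_e q * (x UY - y UY)) by ring.
  generalize (H _ UY He); lra.
- replace (_ - _) with (1 * (x UL - y UL) + coef_r (axis Du q t) * (x UY - y UY)) by ring.
  eapply Rle_trans; [apply Rabs_triang|].
  generalize (H 1 UL) (H _ UY Hr); rewrite Rabs_R1; lra.
Qed.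

Lemma ode_continuous q i (w : unknown -> R -> R) t :
  (forall j t, continuous (w j) t) -> D (axis Du q t) ->
  continuous (fun s => ode q i s (fun j => w j s)) t.
Proof.
intros cw Dt.
assert (cl : forall F, smooth D F -> continuous (fun s => F (axis Du q s)) t).
{ intros F HF. apply (continuous_comp (axis Du q) F). apply continuous_axis.
  now apply smooth_continuous with D. }
assert (cn := cl _ (cp_snu cpt)).
assert (ck := cl _ smooth_coef_k). assert (cr := cl _ smooth_coef_r).
assert (cm : forall F j, continuous (fun s => F (axis Du q s)) t ->
  continuous (fun s => F (axis Du q s) * w j s) t).
{ intros F j HF. apply continuous_Rmult; trivial; apply cw. }
destruct i.
- apply (cm (fun p => - nu p)). now apply continuous_Ropp.
- apply continuous_Rplus; [apply (cm (fun p => - nu p)); now apply continuous_Ropp|now apply cm].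
- apply continuous_Rplus; [now apply cm|].
  apply (cm (fun _ => coef_e q)). apply continuous_const.
- apply (cm (fun _ => coef_e q)). apply continuous_const.
- apply continuous_Rplus; [apply cw|now apply cm].
Qed.

(** The unknowns of the reduced system are frozen at the ordinate of [q]: their
coefficients take the same values there as at any other ordinate of the square. *)
Lemma local_solution q : D q -> exists d : posreal,
  (forall p, ball q d p -> D p) /\
  forall r z0 x0 y0 m0 n0, ball q d r -> exists z x y m n,
    integral_on (ball q d) f g la mu nu z x y m n /\
    z r = z0 /\ x r = x0 /\ y r = y0 /\ m r = m0 /\ n r = n0.
Proof.
intros Dq.
set (K := 1 + Rabs (nu q) + Rabs (coef_k q) + Rabs (coef_r q) + Rabs (coef_e q)).
assert (Kn := Rabs_pos (nu q)). assert (Kk := Rabs_pos (coef_k q)).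
assert (Kr := Rabs_pos (coef_r q)). assert (Ke := Rabs_pos (coef_e q)).
assert (K1 : 1 <= K) by (unfold K; lra).
assert (L : locally q (fun p =>
  D p /\ Rabs (nu p) < K /\ Rabs (coef_k p) < K /\ Rabs (coef_r p) < K)).
{ repeat apply filter_and; [now apply oD| | |];
  (apply locally_Rabs_lt; [|unfold K; lra]); apply smooth_continuous with D; trivial.
  apply smooth_coef_k. apply smooth_coef_r. }
destruct L as [d0 Hd0].
assert (Hpos : 0 < Rmin (d0 / 2) (1 / (8 * K))).
{ apply Rmin_pos; [generalize (cond_pos d0); lra|]. apply Rdiv_lt_0_compat; lra. }
set (d := mkposreal _ Hpos).
assert (dd0 : d <= d0 / 2) by apply Rmin_l.
assert (dK : 4 * K * d <= 1 / 2).
{ apply Rle_trans with (4 * K * (1 / (8 * K))).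
  - apply Rmult_le_compat_l; [lra|apply Rmin_r].
  - right; field; lra. }
assert (posd := cond_pos d). assert (posd0 := cond_pos d0).
assert (seg : forall t, fst q - d <= t <= fst q + d -> ball q d0 (axis Du q t)).
{ intros t Ht; split; simpl; [|apply ball_center].
  apply Rabs_def1; unfold minus, plus, opp; simpl; lra. }
exists d. split.
{ intros p Hp. apply Hd0. apply ball_le with d; trivial; lra. }
intros r z0 x0 y0 m0 n0 Hr.
assert (inD : forall p, ball q d p -> D p).
{ intros p Hp. apply Hd0. apply ball_le with d; trivial; lra. }
assert (Dr := inD r Hr).
(* Initial values of the reduced unknowns: the explicit formulas, inverted at r. *)
set (Y0 := y0 / f r). set (M0 := m0 - null_angle r * Y0).
set (L0 := f r * x0 - null_angle r ^ 2 / 2 * Y0 - null_angle r * M0).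
set (Z0 := z0 + null_angle r / nu r * Y0).
set (c i := match i with UY => Y0 | UM => M0 | UL => L0 | UN => n0 | UZ => Z0 end).
destruct (picard unknown (ode q) (fst q - d) (fst q + d) (2 * K)
  (2 * K * (Rabs Y0 + Rabs M0 + Rabs L0 + Rabs n0 + Rabs Z0)) (fst r) c)
  as [w [w0 [cw dw]]].
- destruct Hr as [Hr _]. apply Rabs_def2 in Hr.
  unfold minus, plus, opp in Hr; simpl in Hr. simpl; lra.
- lra.
- lra.
- intros i w cw t Ht. apply ode_continuous; trivial. apply Hd0; auto.
- intros i t x y e Ht. destruct (Hd0 _ (seg t Ht)) as [_ [H1 [H2 H3]]].
  apply ode_lipschitz; try lra. unfold K; lra.
- intros i t Ht. destruct (Hd0 _ (seg t Ht)) as [_ [H1 [H2 H3]]].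
  replace (ode q i t c) with (ode q i t c - ode q i t (fun _ => 0)).
  + apply ode_lipschitz; try lra; [unfold K; lra|].
    intros j; rewrite Rminus_0_r.
    generalize (Rabs_pos Y0) (Rabs_pos M0) (Rabs_pos L0) (Rabs_pos n0) (Rabs_pos Z0).
    destruct j; simpl; lra.
  + destruct i; simpl; ring.
- set (Y (p : R * R) := w UY (fst p)). set (M (p : R * R) := w UM (fst p)).
  set (L (p : R * R) := w UL (fst p)).
  set (N (p : R * R) := w UN (fst p)). set (Z (p : R * R) := w UZ (fst p)).
  exists (fun p : R * R => Z p - null_angle p / nu p * Y p).
  exists (fun p : R * R => (null_angle p ^ 2 / 2 * Y p + null_angle p * M p + L p) / f p).
  exists (fun p : R * R => f p * Y p).
  exists (fun p : R * R => null_angle p * Y p + M p).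
  exists N.
  assert (fr : f r <> 0) by (apply Rgt_not_eq, cpt; trivial).
  split; [|repeat split; unfold Y, M, L, N, Z; rewrite ?w0; simpl;
    unfold Z0, L0, M0, Y0; first [ now field | trivial ];
    field; repeat split; trivial; now apply cpt].
  intros p Hp. assert (Dp := inD p Hp).
  assert (fp : f p <> 0) by (apply Rgt_not_eq, cpt; trivial).
  assert (np : nu p <> 0) by (apply cpt; trivial).
  assert (cf : forall i, continuous (fun p : R * R => w i (fst p)) p).
  { intros i. apply (continuous_comp fst (w i)). apply continuous_fst. apply cw. }
  assert (dv : forall i, is_pd Dv (fun p : R * R => w i (fst p)) p 0).
  { intros i. apply (is_pd_const Dv (w i (fst p))). }
  assert (along : forall F, (forall p, D p -> is_pd Dv F p 0) ->
    F (axis Du q (fst p)) = F p).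
  { intros F HF. transitivity (F (fst p, snd p)); [|now destruct p]. symmetry.
    apply (rectangular_constant_v (ball q d)); auto using ball_center.
    apply rectangular_ball. }
  assert (du : forall i, is_pd Du (fun p : R * R => w i (fst p)) p
    (ode q i (fst p) (fun j => w j (fst p)))).
  { intros i. apply dw. destruct Hp as [Hp _]. apply Rabs_def2 in Hp.
    unfold minus, plus, opp in Hp; simpl in Hp. simpl; lra. }
  assert (eqp : coef_e q = coef_e p).
  { apply (rectangular_constant (ball q d)); auto using ball_center.
    apply rectangular_ball. intros; apply coef_e_constant; auto. }
  assert (nup : nu (axis Du q (fst p)) = nu p).
  { apply along. intros p' Dp'. eapply is_pd_val; [|now apply (cp_nuv cpt p')]. pd_atom. }
  assert (kp := along coef_k coef_k_v). assert (rp := along coef_r coef_r_v).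
  assert (Yu := du UY). assert (Mu := du UM). assert (Lu := du UL).
  assert (Nu := du UN). assert (Zu := du UZ).
  unfold ode in Yu, Mu, Lu, Nu, Zu. rewrite nup, ?kp, ?rp, ?eqp in *.
  change (is_pd Du Y p (- nu p * M p)) in Yu.
  change (is_pd Du M p (- nu p * L p + coef_k p * Y p)) in Mu.
  change (is_pd Du L p (coef_k p * M p + coef_e p * N p)) in Lu.
  change (is_pd Du N p (coef_e p * Y p)) in Nu.
  change (is_pd Du Z p (L p + coef_r p * Y p)) in Zu.
  assert (Yv : is_pd Dv Y p 0) by apply dv. assert (Mv : is_pd Dv M p 0) by apply dv.
  assert (Lv : is_pd Dv L p 0) by apply dv. assert (Nv : is_pd Dv N p 0) by apply dv.
  assert (Zv : is_pd Dv Z p 0) by apply dv.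
  assert (hu : is_pd Du null_angle p (pd Du null_angle p)).
  { apply smooth_is_pd with D; trivial. apply smooth_null_angle. }
  assert (hv := null_angle_v p Dp).
  assert (gu : pd Du g p = - null_angle p * nu p / 2) by (unfold null_angle; now field).
  assert (dfi := fun i => cp_df cpt i p Dp).
  assert (fd : forall i, is_pd i f p (f p * pd i g p)).
  { intros i; rewrite <- dfi. now apply smooth_is_pd with D. }
  assert (fu := fd Du). assert (fv := fd Dv).
  assert (nuu : is_pd Du nu p (pd Du nu p)) by (apply smooth_is_pd with D; trivial).
  assert (nuv : is_pd Dv nu p 0).
  { rewrite <- (cp_nuv cpt p Dp). apply smooth_is_pd with D; trivial. }
  assert (huu : is_pd Du (pd Du null_angle) p (pd Du (pd Du null_angle) p)).
  { apply smooth_is_pd with D; trivial. apply smooth_pd, smooth_null_angle. }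
  assert (cH : continuous null_angle p)
    by (apply smooth_continuous with D; trivial; apply smooth_null_angle).
  assert (cF : continuous f p) by (apply smooth_continuous with D; trivial).
  assert (cN : continuous nu p) by (apply smooth_continuous with D; trivial).
  assert (cY : continuous Y p) by apply cf. assert (cM : continuous M p) by apply cf.
  assert (cL : continuous L p) by apply cf. assert (cNN : continuous N p) by apply cf.
  assert (cZ : continuous Z p) by apply cf.
  assert (cQ : continuous (fun p => null_angle p / nu p) p).
  { apply continuous_Rmult; trivial. now apply continuous_Rinv. }
  clearbody Y M L N Z.
  clear - fp np Yu Mu Lu Nu Zu Yv Mv Lv Nv Zv hu hv gu fu fv nuu nuv cH cF cN cY cM cL cNN cZ cQ.
  split.
  + split.
    all: pd_solve ltac:(idtac; first [assumption | lra]); rewrite ?gu;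
      unfold coef_r, coef_k, coef_e; field; auto.
  + split; [|split; [|split; [|split]]].
    * apply continuous_Rminus; trivial.
      apply continuous_Rmult; trivial.
    * apply continuous_Rmult; [|now apply continuous_Rinv].
      apply continuous_Rplus; trivial. apply continuous_Rplus; trivial;
      apply continuous_Rmult; trivial.
      apply (continuous_comp null_angle (fun t => t ^ 2 / 2)); trivial.
      apply (@ex_derive_continuous R_AbsRing R_NormedModule). auto_derive; trivial.
    * now apply continuous_Rmult.
    * apply continuous_Rplus; trivial. now apply continuous_Rmult.
    * trivial.
Qed.

End LocalSolution.

(** * Pseudo-orthonormal frames of Minkowski space *)

Inductive coord := K1 | K2 | K3 | K4.

Definition co (k : coord) : R4 -> R :=
  match k with K1 => c1 | K2 => c2 | K3 => c3 | K4 => c4 end.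

Definition R4_of (F : coord -> R) : R4 := vec (F K1) (F K2) (F K3) (F K4).

Lemma co_of F k : co k (R4_of F) = F k.
Proof. now destruct k. Qed.

Lemma R4_ext a b : (forall k, co k a = co k b) -> a = b.
Proof.
intros H. generalize (H K1) (H K2) (H K3) (H K4).
destruct a as [[[a1 a2] a3] a4], b as [[[b1 b2] b3] b4]; simpl.
unfold c1, c2, c3, c4; simpl. now intros -> -> -> ->.
Qed.

Lemma co_plus k a b : co k (plus a b) = co k a + co k b.
Proof. now destruct k. Qed.
Lemma co_scal k t a : co k (scal t a) = t * co k a.
Proof. now destruct k. Qed.
Lemma co_minus k a b : co k (minus a b) = co k a - co k b.
Proof. now destruct k. Qed.
Lemma co_zero k : co k zero = 0.
Proof. now destruct k. Qed.
Lemma co_vpd k i z p : co k (vpd i z p) = pd i (fun q => co k (z q)) p.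
Proof. now destruct k. Qed.

Lemma co_lincomb k x y m n a b c d :
  co k (lincomb x y m n (a, b, c, d)) =
  a * co k x + b * co k y + (c * co k m + d * co k n).
Proof. unfold lincomb. now rewrite !co_plus, !co_scal. Qed.

Lemma mink_co a b : mink a b =
  co K1 a * co K1 b + co K2 a * co K2 b + co K3 a * co K3 b - co K4 a * co K4 b.
Proof. reflexivity. Qed.

Lemma mink_plus_l a b w : mink (plus a b) w = mink a w + mink b w.
Proof. rewrite !mink_co, !co_plus; ring. Qed.
Lemma mink_scal_l t a w : mink (scal t a) w = t * mink a w.
Proof. rewrite !mink_co, !co_scal; ring. Qed.
Lemma mink_minus_l a b w : mink (minus a b) w = mink a w - mink b w.
Proof. rewrite !mink_co, !co_minus; ring. Qed.
Lemma mink_zero_l w : mink zero w = 0.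
Proof. rewrite !mink_co, !co_zero; ring. Qed.
Lemma mink_plus_r a b w : mink w (plus a b) = mink w a + mink w b.
Proof. rewrite !mink_co, !co_plus; ring. Qed.
Lemma mink_scal_r t a w : mink w (scal t a) = t * mink w a.
Proof. rewrite !mink_co, !co_scal; ring. Qed.
Lemma mink_minus_r a b w : mink w (minus a b) = mink w a - mink w b.
Proof. rewrite !mink_co, !co_minus; ring. Qed.
Lemma mink_zero_r w : mink w zero = 0.
Proof. rewrite !mink_co, !co_zero; ring. Qed.

Record gram (x y m n : R4) : Prop := {
  g_xx : mink x x = 0; g_yy : mink y y = 0; g_xy : mink x y = -1;
  g_mm : mink m m = 1; g_nn : mink n n = 1; g_mn : mink m n = 0;
  g_xm : mink x m = 0; g_xn : mink x n = 0; g_ym : mink y m = 0; g_yn : mink y n = 0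
}.

Arguments g_xx {x y m n}.
Arguments g_yy {x y m n}.
Arguments g_xy {x y m n}.
Arguments g_mm {x y m n}.
Arguments g_nn {x y m n}.
Arguments g_mn {x y m n}.
Arguments g_xm {x y m n}.
Arguments g_xn {x y m n}.
Arguments g_ym {x y m n}.
Arguments g_yn {x y m n}.

(** The dual basis of a pseudo-orthonormal frame is the frame itself, with the
null vectors exchanged and their signs changed. *)
Definition expansion (x y m n : R4) : Prop := forall w k,
  co k w = - mink w y * co k x - mink w x * co k y + mink w m * co k m + mink w n * co k n.

Definition eta (j k : coord) : R :=
  match j, k with
  | K1, K1 | K2, K2 | K3, K3 => 1
  | K4, K4 => -1
  | _, _ => 0
  end.

(** The bilinear form in which the coefficient matrices of the structure
equations are skew: its values on two solutions are constant. *)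
Definition pairing (a b c d a' b' c' d' : R) : R := - (a * b' + b * a') + c * c' + d * d'.

Definition tensor (x y m n x' y' m' n' : R4) (j k : coord) : R :=
  pairing (co j x) (co j y) (co j m) (co j n) (co k x') (co k y') (co k m') (co k n').

(** Lowering the first index of the tensor with the Minkowski metric turns the
completeness relation into the expansion of a vector in the frame. *)
Lemma tensor_contract x y m n x' y' m' n' w k :
  (forall j k, tensor x y m n x' y' m' n' j k = eta j k) ->
  co k w = - mink w y * co k x' - mink w x * co k y' + mink w m * co k m' + mink w n * co k n'.
Proof.
intros H. transitivity
  (co K1 w * tensor x y m n x' y' m' n' K1 k + co K2 w * tensor x y m n x' y' m' n' K2 k +
   co K3 w * tensor x y m n x' y' m' n' K3 k - co K4 w * tensor x y m n x' y' m' n' K4 k).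
- rewrite !H. destruct k; simpl; ring.
- rewrite !mink_co. unfold tensor, pairing. ring.
Qed.

Lemma expansion_tensor x y m n j k : expansion x y m n -> tensor x y m n x y m n j k = eta j k.
Proof.
intros H. set (w := R4_of (eta j)). generalize (H w k). unfold tensor, pairing.
rewrite !mink_co. unfold w; rewrite !co_of.
destruct j; simpl; intros E; rewrite ?E; destruct k; simpl in *; lra.
Qed.

(** A frame is determined by its completeness relation with an orthonormal one. *)
Lemma gram_unique x y m n x' y' m' n' : gram x y m n ->
  (forall j k, tensor x y m n x' y' m' n' j k = eta j k) ->
  x' = x /\ y' = y /\ m' = m /\ n' = n.
Proof.
intros G H.
assert (E := fun w k => tensor_contract _ _ _ _ _ _ _ _ w k H).
destruct G as [xx yy xy mm nn mn xm xn ym yn].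
repeat split; apply R4_ext; intros k; symmetry; rewrite E;
rewrite ?(mink_sym y x), ?(mink_sym m x), ?(mink_sym n x), ?(mink_sym m y),
  ?(mink_sym n y), ?(mink_sym n m), ?xx, ?yy, ?xy, ?mm, ?nn, ?mn, ?xm, ?xn, ?ym, ?yn; ring.
Qed.

Lemma pseudo_orthonormal_gram {x y m n} : pseudo_orthonormal x y m n -> gram x y m n.
Proof. intros [_ H]; split; apply H. Qed.

Lemma pseudo_orthonormal_expansion {x y m n} :
  pseudo_orthonormal x y m n -> expansion x y m n.
Proof.
intros H w k. assert (G := pseudo_orthonormal_gram H).
destruct H as [B _]. destruct (B w) as [[[[a b] c] d] [-> _]].
rewrite co_lincomb. unfold lincomb.
rewrite !mink_plus_l, !mink_scal_l.
rewrite ?(mink_sym y x), ?(mink_sym m x), ?(mink_sym n x), ?(mink_sym m y),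
  ?(mink_sym n y), ?(mink_sym n m); destruct G as [xx yy xy mm nn mn xm xn ym yn];
rewrite ?xx, ?yy, ?xy, ?mm, ?nn, ?mn, ?xm, ?xn, ?ym, ?yn; ring.
Qed.

Definition det3 (a1 a2 a3 b1 b2 b3 c1 c2 c3 : R) : R :=
  a1 * (b2 * c3 - b3 * c2) - a2 * (b1 * c3 - b3 * c1) + a3 * (b1 * c2 - b2 * c1).

Definition det4 (a b c d : R4) : R :=
  c1 a * det3 (c2 b) (c3 b) (c4 b) (c2 c) (c3 c) (c4 c) (c2 d) (c3 d) (c4 d)
  - c2 a * det3 (c1 b) (c3 b) (c4 b) (c1 c) (c3 c) (c4 c) (c1 d) (c3 d) (c4 d)
  + c3 a * det3 (c1 b) (c2 b) (c4 b) (c1 c) (c2 c) (c4 c) (c1 d) (c2 d) (c4 d)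
  - c4 a * det3 (c1 b) (c2 b) (c3 b) (c1 c) (c2 c) (c3 c) (c1 d) (c2 d) (c3 d).

Definition combine (x y m n : R4) (w : R4) (s : coord -> R) : Prop :=
  forall k, co k w = s K1 * co k x + s K2 * co k y + s K3 * co k m + s K4 * co k n.

Lemma det4_linear x y m n w s b c d : combine x y m n w s ->
  det4 w b c d = s K1 * det4 x b c d + s K2 * det4 y b c d +
    s K3 * det4 m b c d + s K4 * det4 n b c d.
Proof.
intros H. generalize (H K1) (H K2) (H K3) (H K4); simpl.
intros E1 E2 E3 E4. unfold det4; rewrite E1, E2, E3, E4; ring.
Qed.

Lemma det4_swap12 a b c d : det4 a b c d = - det4 b a c d.
Proof. unfold det4, det3; ring. Qed.
Lemma det4_swap23 a b c d : det4 a b c d = - det4 a c b d.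
Proof. unfold det4, det3; ring. Qed.
Lemma det4_swap34 a b c d : det4 a b c d = - det4 a b d c.
Proof. unfold det4, det3; ring. Qed.
Lemma det4_same12 a c d : det4 a a c d = 0.
Proof. unfold det4, det3; ring. Qed.
Lemma det4_same13 a c d : det4 a c a d = 0.
Proof. unfold det4, det3; ring. Qed.
Lemma det4_same14 a c d : det4 a c d a = 0.
Proof. unfold det4, det3; ring. Qed.
Lemma det4_same23 a c d : det4 c a a d = 0.
Proof. unfold det4, det3; ring. Qed.
Lemma det4_same24 a c d : det4 c a d a = 0.
Proof. unfold det4, det3; ring. Qed.
Lemma det4_same34 a c d : det4 c d a a = 0.
Proof. unfold det4, det3; ring. Qed.

(** If the determinant vanished on four spanning vectors, it would vanish
identically: replace the arguments one after the other by arbitrary vectors. *)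
Lemma det4_spanning x y m n :
  (forall w, exists s, combine x y m n w s) -> det4 x y m n <> 0.
Proof.
intros span H.
set (V := fun v => v = x \/ v = y \/ v = m \/ v = n).
assert (fill : forall b c d, (forall v, V v -> det4 v b c d = 0) ->
  forall w, det4 w b c d = 0).
{ intros b c d HV w. destruct (span w) as [s Hs].
  rewrite (det4_linear _ _ _ _ _ _ b c d Hs).
  rewrite !HV by (unfold V; auto). ring. }
assert (D0 : forall a b c d, V a -> V b -> V c -> V d -> det4 a b c d = 0).
{ intros a b c d [->|[->|[->| ->]]] [->|[->|[->| ->]]] [->|[->|[->| ->]]] [->|[->|[->| ->]]];
  first [ apply det4_same12 | apply det4_same13 | apply det4_same14
        | apply det4_same23 | apply det4_same24 | apply det4_same34
        | rewrite <- H; unfold det4, det3; ring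
        | rewrite <- Ropp_0, <- H; unfold det4, det3; ring ]. }
assert (D1 : forall a b c d, V b -> V c -> V d -> det4 a b c d = 0).
{ intros a b c d Hb Hc Hd. apply fill; auto. }
assert (D2 : forall a b c d, V c -> V d -> det4 a b c d = 0).
{ intros a b c d Hc Hd. rewrite det4_swap12, fill; [ring|].
  intros v Hv. rewrite det4_swap12, D1; trivial; ring. }
assert (D3 : forall a b c d, V d -> det4 a b c d = 0).
{ intros a b c d Hd. rewrite det4_swap23, det4_swap12, fill; [ring|].
  intros v Hv. rewrite det4_swap12, det4_swap23, D2; trivial; ring. }
assert (D4 : forall a b c d, det4 a b c d = 0).
{ intros a b c d. rewrite det4_swap34, det4_swap23, det4_swap12, fill; [ring|].
  intros v Hv. rewrite det4_swap12, det4_swap23, det4_swap34, D3; trivial; ring. }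
generalize (D4 (vec 1 0 0 0) (vec 0 1 0 0) (vec 0 0 1 0) (vec 0 0 0 1)).
unfold det4, det3, vec, c1, c2, c3, c4; simpl; lra.
Qed.

Lemma spanning_free x y m n : (forall w, exists s, combine x y m n w s) ->
  forall s, combine x y m n zero s -> forall j, s j = 0.
Proof.
intros span s Hs. assert (H := det4_spanning x y m n span).
assert (z : forall b c d, det4 zero b c d = 0).
{ intros b c d; unfold det4.
  change (c1 zero) with 0; change (c2 zero) with 0;
  change (c3 zero) with 0; change (c4 zero) with 0. ring. }
assert (Hl := fun b c d => det4_linear _ _ _ _ _ _ b c d Hs).
intros j; apply (Rmult_eq_reg_r (det4 x y m n)); trivial; rewrite Rmult_0_l.
destruct j.
- generalize (Hl y m n). rewrite z, det4_same12, det4_same13, det4_same14. lra.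
- generalize (Hl x m n). rewrite z, det4_same12, det4_same13, det4_same14.
  rewrite (det4_swap12 y). lra.
- generalize (Hl x y n). rewrite z, det4_same12, det4_same13, det4_same14.
  rewrite (det4_swap12 m), (det4_swap23 x m). lra.
- generalize (Hl x y m). rewrite z, det4_same12, det4_same13, det4_same14.
  rewrite (det4_swap12 n), (det4_swap23 x n), (det4_swap34 x y n). lra.
Qed.

(** Completeness forces orthonormality: expanding a frame vector in the frame
itself gives two expressions of it, whose coefficients agree. *)
Lemma expansion_pseudo_orthonormal x y m n :
  expansion x y m n -> pseudo_orthonormal x y m n.
Proof.
intros E.
set (cf w j := match j with
  | K1 => - mink w y | K2 => - mink w x | K3 => mink w m | K4 => mink w n end).
assert (span : forall w, exists s, combine x y m n w s).
{ intros w; exists (cf w). intros k. rewrite (E w k). simpl; ring. }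
assert (free := spanning_free x y m n span).
assert (uniq : forall w s, combine x y m n w s -> forall j, s j = cf w j).
{ intros w s Hs j. apply Rminus_diag_uniq.
  apply (free (fun j => s j - cf w j)). intros k.
  rewrite co_zero. generalize (Hs k) (E w k). simpl; intros E1 E2. lra. }
assert (d : forall j w, w = match j with K1 => x | K2 => y | K3 => m | K4 => n end ->
  combine x y m n w (fun i => match j, i with
    | K1, K1 | K2, K2 | K3, K3 | K4, K4 => 1 | _, _ => 0 end)).
{ intros j w -> k; destruct j; simpl; ring. }
assert (ux := uniq x _ (d K1 x eq_refl)). assert (uy := uniq y _ (d K2 y eq_refl)).
assert (um := uniq m _ (d K3 m eq_refl)). assert (un := uniq n _ (d K4 n eq_refl)).
split.
- intros w. exists (- mink w y, - mink w x, mink w m, mink w n). split.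
  + apply R4_ext; intros k. rewrite co_lincomb, (E w k); ring.
  + intros [[[a b] c] e] Hw.
    assert (Hs : combine x y m n w (fun j =>
      match j with K1 => a | K2 => b | K3 => c | K4 => e end)).
    { intros k. rewrite Hw, co_lincomb; ring. }
    assert (H := uniq w _ Hs).
    generalize (H K1) (H K2) (H K3) (H K4); simpl. now intros -> -> -> ->.
- generalize (ux K1) (ux K2) (ux K3) (ux K4) (uy K1) (uy K3) (uy K4) (um K3) (um K4) (un K4).
  unfold cf. intros. repeat split; lra.
Qed.

(** * Integral frame fields: invariants, uniqueness and global existence *)

Record frame := Frame { pt : R4; vx : R4; vy : R4; vm : R4; vn : R4 }.

Definition orthonormal (F : frame) : Prop :=
  pseudo_orthonormal (vx F) (vy F) (vm F) (vn F).

Lemma frame_eq F F' : pt F = pt F' -> vx F = vx F' -> vy F = vy F' ->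
  vm F = vm F' -> vn F = vn F' -> F = F'.
Proof. destruct F, F'; simpl; now intros -> -> -> -> ->. Qed.

Definition frame_eqs (f g la mu nu : R * R -> R) (F : R * R -> frame) (p : R * R) : Prop :=
  forall k, structure_eqs f g la mu nu
    (fun q => co k (pt (F q))) (fun q => co k (vx (F q))) (fun q => co k (vy (F q)))
    (fun q => co k (vm (F q))) (fun q => co k (vn (F q))) p.

Definition integral_frame (S : R * R -> Prop) (f g la mu nu : R * R -> R)
    (F : R * R -> frame) : Prop :=
  forall k, integral_on S f g la mu nu
    (fun q => co k (pt (F q))) (fun q => co k (vx (F q))) (fun q => co k (vy (F q)))
    (fun q => co k (vm (F q))) (fun q => co k (vn (F q))).

Lemma pairing_constant f g la mu nu z x y m n z' x' y' m' n' i p :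
  structure_eqs f g la mu nu z x y m n p ->
  structure_eqs f g la mu nu z' x' y' m' n' p ->
  is_pd i (fun q => pairing (x q) (y q) (m q) (n q) (x' q) (y' q) (m' q) (n' q)) p 0.
Proof.
intros [zu zv xu xv yu yv mu_ mv nu_ nv] [zu' zv' xu' xv' yu' yv' mu' mv' nu' nv'].
unfold pairing.
destruct i; pd_solve fail; ring.
Qed.

Section Integral.

Variables (f g la mu nu : R * R -> R).

Lemma tensor_constant S F F' : domain S ->
  (forall p, S p -> frame_eqs f g la mu nu F p) ->
  (forall p, S p -> frame_eqs f g la mu nu F' p) ->
  forall p0, S p0 -> orthonormal (F p0) -> F' p0 = F p0 ->
  forall p, S p -> forall j k, tensor (vx (F p)) (vy (F p)) (vm (F p)) (vn (F p))
    (vx (F' p)) (vy (F' p)) (vm (F' p)) (vn (F' p)) j k = eta j k.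
Proof.
intros dS HF HF' p0 Sp0 O E p Sp j k.
transitivity (tensor (vx (F p0)) (vy (F p0)) (vm (F p0)) (vn (F p0))
    (vx (F' p0)) (vy (F' p0)) (vm (F' p0)) (vn (F' p0)) j k).
- apply (domain_constant S (fun p => tensor (vx (F p)) (vy (F p)) (vm (F p)) (vn (F p))
    (vx (F' p)) (vy (F' p)) (vm (F' p)) (vn (F' p)) j k)); trivial.
  intros i q Sq.
  exact (pairing_constant _ _ _ _ _ _ _ _ _ _ _ _ _ _ _ i q (HF q Sq j) (HF' q Sq k)).
- rewrite E. now apply expansion_tensor, pseudo_orthonormal_expansion.
Qed.

(** The completeness relation is the constant tensor of the field with itself. *)
Lemma orthonormal_propagates S F : domain S ->
  (forall p, S p -> frame_eqs f g la mu nu F p) ->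
  forall p0, S p0 -> orthonormal (F p0) -> forall p, S p -> orthonormal (F p).
Proof.
intros dS HF p0 Sp0 O p Sp.
apply (expansion_pseudo_orthonormal (vx (F p)) (vy (F p)) (vm (F p)) (vn (F p))).
intros w k. apply tensor_contract.
exact (tensor_constant S F F dS HF HF p0 Sp0 O eq_refl p Sp).
Qed.

(** The tensor of the two fields keeps the value [eta] that it has for a field
with itself, so the frames agree; then the position vectors have the same
derivatives. *)
Lemma integral_frame_unique S F F' : domain S ->
  (forall p, S p -> frame_eqs f g la mu nu F p) ->
  (forall p, S p -> frame_eqs f g la mu nu F' p) ->
  forall p0, S p0 -> orthonormal (F p0) -> F' p0 = F p0 ->
  forall p, S p -> F' p = F p.
Proof.
intros dS HF HF' p0 Sp0 O E.
assert (fr : forall p, S p -> vx (F' p) = vx (F p) /\ vy (F' p) = vy (F p) /\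
  vm (F' p) = vm (F p) /\ vn (F' p) = vn (F p)).
{ intros p Sp. apply gram_unique.
  - apply pseudo_orthonormal_gram. exact (orthonormal_propagates S F dS HF p0 Sp0 O p Sp).
  - exact (tensor_constant S F F' dS HF HF' p0 Sp0 O E p Sp). }
intros p Sp. destruct (fr p Sp) as [Ex [Ey [Em En]]].
apply frame_eq; trivial. apply R4_ext; intros k. apply Rminus_diag_uniq.
transitivity (co k (pt (F' p0)) - co k (pt (F p0))); [|rewrite E; ring].
apply (domain_constant S (fun p => co k (pt (F' p)) - co k (pt (F p)))); trivial.
intros i q Sq. destruct (fr q Sq) as [Ex' [Ey' _]].
destruct i; (eapply is_pd_val; [apply is_pd_minus; [apply (HF' q Sq k)|apply (HF q Sq k)]|]);
cbv beta; rewrite ?Ex', ?Ey'; ring.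
Qed.

Lemma integral_frame_eqs S F : integral_frame S f g la mu nu F ->
  forall p, S p -> frame_eqs f g la mu nu F p.
Proof. intros H p Sp k; exact (proj1 (H k p Sp)). Qed.

Lemma integral_frame_ext S F F' : open S -> (forall p, S p -> F p = F' p) ->
  integral_frame S f g la mu nu F -> integral_frame S f g la mu nu F'.
Proof.
intros oS E HF k p Sp. destruct (HF k p Sp) as [[] C].
assert (P : forall i (h : frame -> R4) l, is_pd i (fun q => co k (h (F q))) p l ->
  is_pd i (fun q => co k (h (F' q))) p l).
{ intros i h l. apply (is_pd_on i S (fun q => co k (h (F q)))); trivial.
  intros q Sq; now rewrite (E q Sq). }
split.
- split; rewrite <- ?(E p Sp);
  [ now apply (P Du pt) | now apply (P Dv pt) | now apply (P Du vx) | now apply (P Dv vx)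
  | now apply (P Du vy) | now apply (P Dv vy) | now apply (P Du vm) | now apply (P Dv vm)
  | now apply (P Du vn) | now apply (P Dv vn) ].
- assert (C' : forall h : frame -> R4, continuous (fun q => co k (h (F q))) p ->
    continuous (fun q => co k (h (F' q))) p).
  { intros h. apply (continuous_on S (fun q => co k (h (F q)))); trivial.
    intros q Sq; now rewrite (E q Sq). }
  destruct C as [Cz [Cx [Cy [Cm Cn]]]].
  split; [now apply C'|split; [now apply C'|split; [now apply C'|split; now apply C']]].
Qed.

(** A patch carries an integral frame field for every initial frame at every
one of its points; being rectangular, it meets other patches in connected sets. *)
Definition patch (D Q : R * R -> Prop) : Prop :=
  domain Q /\ rectangular Q /\ (forall p, Q p -> D p) /\
  forall p F0, Q p -> exists F, integral_frame Q f g la mu nu F /\ F p = F0.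

Lemma patch_exists D : compatible D f g la mu nu ->
  forall p, D p -> exists Q, patch D Q /\ Q p.
Proof.
intros cpt p Dp. destruct (local_solution D f g la mu nu cpt p Dp) as [d [sub sol]].
exists (ball p d). split; [|apply ball_center].
assert (ob : open (ball p d)).
{ intros q Hq. assert (d0 : 0 < d - Rmax (Rabs (fst q - fst p)) (Rabs (snd q - snd p))).
  { destruct Hq as [Hu Hv]. unfold Rmax; destruct Rle_dec.
    - change (Rabs (snd q - snd p) < d) in Hv; lra.
    - change (Rabs (fst q - fst p) < d) in Hu; lra. }
  exists (mkposreal _ d0). intros r [Hu Hv].
  change (Rabs (fst r - fst q) < d - Rmax (Rabs (fst q - fst p)) (Rabs (snd q - snd p))) in Hu.
  change (Rabs (snd r - snd q) < d - Rmax (Rabs (fst q - fst p)) (Rabs (snd q - snd p))) in Hv.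
  assert (Hl := Rmax_l (Rabs (fst q - fst p)) (Rabs (snd q - snd p))).
  assert (Hr := Rmax_r (Rabs (fst q - fst p)) (Rabs (snd q - snd p))).
  split; [change (Rabs (fst r - fst p) < d)|change (Rabs (snd r - snd p) < d)].
  - generalize (Rabs_triang (fst r - fst q) (fst q - fst p)).
    replace (fst r - fst q + (fst q - fst p)) with (fst r - fst p) by ring. lra.
  - generalize (Rabs_triang (snd r - snd q) (snd q - snd p)).
    replace (snd r - snd q + (snd q - snd p)) with (snd r - snd p) by ring. lra. }
split; [|split; [apply rectangular_ball|split; trivial]].
- apply rectangular_domain; [exact ob|exists p; apply ball_center|apply rectangular_ball].
- intros r F0 Hr.
  assert (H := fun k => sol r (co k (pt F0)) (co k (vx F0)) (co k (vy F0))
    (co k (vm F0)) (co k (vn F0)) Hr).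
  destruct (H K1) as [z1 [x1 [y1 [m1 [n1 [I1 [Z1 [X1 [Y1 [M1 N1]]]]]]]]]].
  destruct (H K2) as [z2 [x2 [y2 [m2 [n2 [I2 [Z2 [X2 [Y2 [M2 N2]]]]]]]]]].
  destruct (H K3) as [z3 [x3 [y3 [m3 [n3 [I3 [Z3 [X3 [Y3 [M3 N3]]]]]]]]]].
  destruct (H K4) as [z4 [x4 [y4 [m4 [n4 [I4 [Z4 [X4 [Y4 [M4 N4]]]]]]]]]].
  exists (fun q => Frame (vec (z1 q) (z2 q) (z3 q) (z4 q)) (vec (x1 q) (x2 q) (x3 q) (x4 q))
    (vec (y1 q) (y2 q) (y3 q) (y4 q)) (vec (m1 q) (m2 q) (m3 q) (m4 q))
    (vec (n1 q) (n2 q) (n3 q) (n4 q))).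
  split.
  + intros []; assumption.
  + apply frame_eq; apply R4_ext; intros []; assumption.
Qed.

(** The last patch meets the union of the others inside the last but one, in a
connected set; there the new solution agrees with the old one as soon as it does
at one point. *)
Lemma chain_integral D p0 F0 U Q : orthonormal F0 -> chain (patch D) p0 U Q ->
  exists F, integral_frame (union U Q) f g la mu nu F /\ F p0 = F0.
Proof.
intros O C. induction C as [Q [dQ [rQ [QD sol]]] Qp|U Q Q' C IH gQ' [q [Qq Q'q]] away].
- destruct (sol p0 F0 Qp) as [F [HF E]]. exists F; split; trivial.
  intros k p [[]|Qp']. now apply HF.
- destruct IH as [F [HF E]].
  assert (dV : domain (union U Q)).
  { apply (chain_domain (patch D) p0); trivial. now intros R [? _]. }
  assert (gQ : patch D Q) by now destruct C.
  destruct gQ as [dQ [rQ [QD _]]]. destruct gQ' as [dQ' [rQ' [QD' sol]]].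
  destruct (sol q (F q) Q'q) as [F' [HF' E']].
  assert (Vq : union U Q q) by now right.
  assert (dI : domain (fun r => Q r /\ Q' r)).
  { apply rectangular_domain.
    - intros r [Qr Q'r]. apply filter_and; [now apply dQ|now apply dQ'].
    - now exists q.
    - now apply rectangular_and. }
  assert (agree : forall r, union U Q r -> Q' r -> F' r = F r).
  { intros r Vr Q'r.
    assert (Qr : Q r) by (destruct Vr; [exfalso; now apply (away r)|trivial]).
    apply (integral_frame_unique (fun r => Q r /\ Q' r) F F') with q; auto.
    - intros s [Qs Q's]. apply (integral_frame_eqs (union U Q)); trivial. now right.
    - intros s [Qs Q's]. now apply (integral_frame_eqs Q').
    - apply (orthonormal_propagates (union U Q)) with p0; trivial.
      + now apply integral_frame_eqs.
      + now apply (chain_in (patch D)).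
      + now rewrite E. }
  set (G r := if excluded_middle_informative (union U Q r) then F r else F' r).
  assert (GF : forall r, union U Q r -> F r = G r).
  { intros r Vr; unfold G; now destruct excluded_middle_informative. }
  assert (GF' : forall r, Q' r -> F' r = G r).
  { intros r Q'r; unfold G; destruct excluded_middle_informative; auto. }
  exists G; split.
  + intros k p [Vp|Q'p].
    * apply (integral_frame_ext (union U Q) F G); trivial. apply dV.
    * apply (integral_frame_ext Q' F' G); trivial. apply dQ'.
  + rewrite <- E. symmetry. apply GF. now apply (chain_in (patch D)).
Qed.

End Integral.

(** * Extrinsic geometry in a null frame *)

Ltac mink_simpl G :=
  repeat rewrite ?mink_plus_l, ?mink_plus_r, ?mink_minus_l, ?mink_minus_r, ?mink_scal_l,
    ?mink_scal_r, ?mink_zero_l, ?mink_zero_r;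
  let xx := fresh in let yy := fresh in let xy := fresh in let mm := fresh in
  let nn := fresh in let mn := fresh in let xm := fresh in let xn := fresh in
  let ym := fresh in let yn := fresh in
  generalize G; intros [xx yy xy mm nn mn xm xn ym yn];
  let f H := rewrite ?H; let H' := fresh in
    assert (H' := H); try rewrite mink_sym in H'; rewrite ?H'; clear H' in
  f xx; f yy; f xy; f mm; f nn; f mn; f xm; f xn; f ym; f yn;
  clear xx yy xy mm nn mn xm xn ym yn.

(** The data at a single point from which the metric, the projections and the
second fundamental form are computed. *)
Record adapted (z : R * R -> R4) (f : R) (x y m n : R4) (p : R * R) : Prop := {
  ad_f : 0 < f;
  ad_u : vpd Du z p = scal f x;
  ad_v : vpd Dv z p = scal f y;
  ad_po : pseudo_orthonormal x y m n
}.

Arguments ad_f {z f x y m n p}.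
Arguments ad_u {z f x y m n p}.
Arguments ad_v {z f x y m n p}.
Arguments ad_po {z f x y m n p}.

Section Adapted.

Context {z : R * R -> R4} {f : R} {x y m n : R4} {p : R * R}.
Hypothesis ad : adapted z f x y m n p.

Let f0 : 0 < f := ad_f ad.
Let G : gram x y m n := pseudo_orthonormal_gram (ad_po ad).
Let E : expansion x y m n := pseudo_orthonormal_expansion (ad_po ad).

Lemma adapted_metric i j : metric z i j p =
  match i, j with Du, Dv | Dv, Du => - f ^ 2 | _, _ => 0 end.
Proof.
unfold metric. destruct i, j; rewrite ?(ad_u ad), ?(ad_v ad);
mink_simpl G; ring.
Qed.

Lemma adapted_metric_det : metric_det z p = - f ^ 4.
Proof. unfold metric_det. rewrite !adapted_metric. ring. Qed.

Lemma adapted_metric_inv i j : metric_inv z i j p =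
  match i, j with Du, Dv | Dv, Du => - / f ^ 2 | _, _ => 0 end.
Proof.
unfold metric_inv. destruct i, j; rewrite adapted_metric_det, adapted_metric; field; lra.
Qed.

Lemma adapted_tcoord i w : tcoord z i p w =
  match i with Du => - mink w y / f | Dv => - mink w x / f end.
Proof.
unfold tcoord, sumd. destruct i; rewrite !adapted_metric_inv,
  ?(ad_u ad), ?(ad_v ad), !mink_scal_r; field; lra.
Qed.

Lemma flat_conn_tangent a b Y :
  flat_conn z p (plus (scal a (vpd Du z p)) (scal b (vpd Dv z p))) Y =
  plus (scal a (vpd Du Y p)) (scal b (vpd Dv Y p)).
Proof.
unfold flat_conn. rewrite !adapted_tcoord, (ad_u ad), (ad_v ad).
mink_simpl G. f_equal; f_equal; field; lra.
Qed.

Lemma flat_conn_u a Y : flat_conn z p (scal a (vpd Du z p)) Y = scal a (vpd Du Y p).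
Proof.
generalize (flat_conn_tangent a 0 Y).
rewrite !(@scal_zero_l R_AbsRing R4), !(@plus_zero_r R4). easy.
Qed.

Lemma flat_conn_v a Y : flat_conn z p (scal a (vpd Dv z p)) Y = scal a (vpd Dv Y p).
Proof.
generalize (flat_conn_tangent 0 a Y).
rewrite !(@scal_zero_l R_AbsRing R4), !(@plus_zero_l R4). easy.
Qed.

Lemma adapted_normal_part w :
  normal_part z p w = plus (scal (mink w m) m) (scal (mink w n) n).
Proof.
unfold normal_part, tangent_part. rewrite !adapted_tcoord, (ad_u ad), (ad_v ad).
apply R4_ext; intros k. rewrite co_minus, !co_plus, !co_scal, (E w k). field; lra.
Qed.

Lemma normal_part_m w : mink (normal_part z p w) m = mink w m.
Proof. rewrite adapted_normal_part. mink_simpl G. ring. Qed.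

Lemma normal_part_n w : mink (normal_part z p w) n = mink w n.
Proof. rewrite adapted_normal_part. mink_simpl G. ring. Qed.

Lemma adapted_sigma_u a Y X : X p = scal a (vpd Du z p) ->
  sigma z X Y p = scal a (normal_part z p (vpd Du Y p)).
Proof.
intros EX. unfold sigma. rewrite EX, flat_conn_u, !adapted_normal_part.
apply R4_ext; intros k. rewrite !co_scal, !co_plus, !co_scal, !mink_scal_l. ring.
Qed.

Lemma adapted_sigma_v a Y X : X p = scal a (vpd Dv z p) ->
  sigma z X Y p = scal a (normal_part z p (vpd Dv Y p)).
Proof.
intros EX. unfold sigma. rewrite EX, flat_conn_v, !adapted_normal_part.
apply R4_ext; intros k. rewrite !co_scal, !co_plus, !co_scal, !mink_scal_l. ring.
Qed.

Lemma adapted_mean_curv : mean_curv z p =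
  scal (- / (2 * f ^ 2)) (plus (normal_part z p (vpd Du (vpd Dv z) p))
                               (normal_part z p (vpd Dv (vpd Du z) p))).
Proof.
unfold mean_curv. rewrite !adapted_metric_inv.
rewrite (adapted_sigma_u 1 (vpd Dv z) (vpd Du z)) by now rewrite (@scal_one R_AbsRing R4).
rewrite (adapted_sigma_v 1 (vpd Du z) (vpd Dv z)) by now rewrite (@scal_one R_AbsRing R4).
apply R4_ext; intros k. repeat rewrite ?co_scal, ?co_plus. field; lra.
Qed.

Lemma adapted_normal : normal z p m /\ normal z p n.
Proof.
split; intros t [a [b ->]]; rewrite (ad_u ad), (ad_v ad);
mink_simpl G; ring.
Qed.

Lemma adapted_immersion a b :
  plus (scal a (vpd Du z p)) (scal b (vpd Dv z p)) = zero -> a = 0 /\ b = 0.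
Proof.
rewrite (ad_u ad), (ad_v ad). intros H.
split; apply (Rmult_eq_reg_r (- f)); try lra; rewrite Rmult_0_l.
- generalize (f_equal (fun w => mink w y) H); cbv beta. mink_simpl G. lra.
- generalize (f_equal (fun w => mink w x) H); cbv beta. mink_simpl G. lra.
Qed.

Lemma adapted_timelike : exists e1 e2, tangent z p e1 /\ tangent z p e2 /\
  mink e1 e1 = 1 /\ mink e2 e2 = -1 /\ mink e1 e2 = 0.
Proof.
exists (plus (scal (/ f) (vpd Du z p)) (scal (- (/ (2 * f))) (vpd Dv z p))).
exists (plus (scal (/ f) (vpd Du z p)) (scal (/ (2 * f)) (vpd Dv z p))).
split; [now exists (/ f), (- / (2 * f))|].
split; [now exists (/ f), (/ (2 * f))|].
rewrite (ad_u ad), (ad_v ad).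
repeat split; mink_simpl G; field; lra.
Qed.

End Adapted.

(** In isotropic parameters the only Christoffel symbols that do not vanish are
those with three equal indices, and the curvature is a mixed derivative of the
logarithm of the metric function. *)
Lemma gauss_curv_isotropic D z f g : open D -> smooth D f -> smooth D g ->
  (forall p, D p -> 0 < f p) ->
  (forall i p, D p -> pd i f p = f p * pd i g p) ->
  (forall i j p, D p -> metric z i j p =
     match i, j with Du, Dv | Dv, Du => - f p ^ 2 | _, _ => 0 end) ->
  forall p, D p -> gauss_curv z p = 2 * pd Dv (pd Du g) p / f p ^ 2.
Proof.
intros oD sf sg f0 df met.
assert (det : forall q, D q -> metric_det z q = - f q ^ 4).
{ intros q Dq. unfold metric_det. rewrite !met by trivial. ring. }
assert (inv : forall i j q, D q -> metric_inv z i j q =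
  match i, j with Du, Dv | Dv, Du => - / f q ^ 2 | _, _ => 0 end).
{ intros i j q Dq. assert (fq := f0 q Dq). unfold metric_inv.
  destruct i, j; rewrite det, met by trivial; field; lra. }
assert (dmet : forall i j l q, D q -> pd i (metric z j l) q =
  match j, l with Du, Dv | Dv, Du => - 2 * f q ^ 2 * pd i g q | _, _ => 0 end).
{ intros i j l q Dq. apply is_pd_unique.
  assert (fd : is_pd i f q (f q * pd i g q)).
  { rewrite <- df by trivial. now apply smooth_is_pd with D. }
  apply (is_pd_on i D (fun r =>
    match j, l with Du, Dv | Dv, Du => - f r ^ 2 | _, _ => 0 end)); trivial.
  - intros r Dr; symmetry; now apply met.
  - destruct j, l; pd_solve fail; ring. }
assert (chr : forall k i j q, D q -> christoffel z k i j q =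
  match k, i, j with
  | Du, Du, Du => 2 * pd Du g q | Dv, Dv, Dv => 2 * pd Dv g q | _, _, _ => 0 end).
{ intros k i j q Dq. assert (fq := f0 q Dq). unfold christoffel, sumd.
  destruct k, i, j; rewrite !inv, !dmet by trivial; field; lra. }
intros p Dp. assert (fp := f0 p Dp).
assert (riem : riemann z Dv p = 2 * pd Dv (pd Du g) p).
{ unfold riemann, sumd.
  rewrite (is_pd_unique Du (christoffel z Dv Dv Dv) p (2 * pd Du (pd Dv g) p)).
  - rewrite (is_pd_unique Dv (christoffel z Dv Du Dv) p 0).
    + rewrite !chr by trivial. rewrite (pd_comm D g p) by trivial. ring.
    + apply (is_pd_on Dv D (fun _ => 0)); trivial; [|apply is_pd_const].
      intros r Dr; now rewrite chr.
  - assert (H : is_pd Du (pd Dv g) p (pd Du (pd Dv g) p)).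
    { apply smooth_is_pd with D; trivial. now apply smooth_pd. }
    apply (is_pd_on Du D (fun r => 2 * pd Dv g r)); trivial.
    + intros r Dr; now rewrite chr.
    + pd_solve fail. ring. }
unfold gauss_curv, sumd. rewrite riem, det, !met by trivial. field; lra.
Qed.

(** * Integral frame fields give solutions *)

(** The unknowns generate a differential algebra over the smooth functions. *)
Lemma integral_smooth D f g la mu nu z x y m n : compatible D f g la mu nu ->
  integral_on D f g la mu nu z x y m n ->
  smooth D z /\ smooth D x /\ smooth D y /\ smooth D m /\ smooth D n.
Proof.
intros [oD sf sg sla smu snu _ _ _ _ _ _ _ _] H.
assert (HS := fun p Dp => proj1 (H p Dp)).
set (X := fun h => h = z \/ h = x \/ h = y \/ h = m \/ h = n).
assert (A : forall h, smooth D h -> alg D X h) by (intros; now apply alg_smooth).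
assert (Az : alg D X z) by (apply alg_gen; unfold X; auto).
assert (Ax : alg D X x) by (apply alg_gen; unfold X; auto).
assert (Ay : alg D X y) by (apply alg_gen; unfold X; auto).
assert (Am : alg D X m) by (apply alg_gen; unfold X; auto 6).
assert (An : alg D X n) by (apply alg_gen; unfold X; auto 6).
assert (M : forall h k, smooth D h -> alg D X k -> alg D X (fun p => h p * k p)).
{ intros h k sh Ak. apply alg_mult; auto. }
assert (P : forall h k, alg D X h -> alg D X k -> alg D X (fun p => h p + k p))
  by (intros; now apply alg_plus).
assert (nfn : smooth D (fun p => - f p * nu p)).
{ apply smooth_mult; trivial. now apply smooth_opp. }
assert (fla : smooth D (fun p => f p * la p)) by now apply smooth_mult.
assert (fmu : smooth D (fun p => f p * mu p)) by now apply smooth_mult.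
assert (gu := smooth_pd _ _ Du sg). assert (gv := smooth_pd _ _ Dv sg).
assert (ngu := smooth_opp _ _ oD gu). assert (ngv := smooth_opp _ _ oD gv).
assert (S : forall h, X h -> (forall p, D p -> continuous h p) /\
     forall i, exists k, alg D X k /\ forall p, D p -> is_pd i h p (k p)).
{ intros h [->|[->|[->|[->| ->]]]]; (split; [intros p Dp; apply (H p Dp)|]); intros [].
  - exists (fun p => f p * x p); split; [now apply M|intros p Dp; now destruct (HS p Dp)].
  - exists (fun p => f p * y p); split; [now apply M|intros p Dp; now destruct (HS p Dp)].
  - exists (fun p => pd Du g p * x p + (f p * la p * m p + f p * mu p * n p)); split.
    + apply P; [|apply P]; apply (M (fun p => _)); trivial.
    + intros p Dp; destruct (HS p Dp). eapply is_pd_val; [eassumption|ring].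
  - exists (fun p => - f p * nu p * m p + - pd Dv g p * x p); split.
    + apply P; apply (M (fun p => _)); trivial.
    + intros p Dp; destruct (HS p Dp). eapply is_pd_val; [eassumption|ring].
  - exists (fun p => - f p * nu p * m p + - pd Du g p * y p); split.
    + apply P; apply (M (fun p => _)); trivial.
    + intros p Dp; destruct (HS p Dp). eapply is_pd_val; [eassumption|ring].
  - exists (fun p => pd Dv g p * y p); split; [now apply M|intros p Dp; now destruct (HS p Dp)].
  - exists (fun p => - f p * nu p * x p + f p * la p * y p); split.
    + apply P; apply (M (fun p => _)); trivial.
    + intros p Dp; now destruct (HS p Dp).
  - exists (fun p => - f p * nu p * y p); split.
    + apply (M (fun p => _)); trivial.
    + intros p Dp; now destruct (HS p Dp).
  - exists (fun p => f p * mu p * y p); split.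
    + apply (M (fun p => _)); trivial.
    + intros p Dp; now destruct (HS p Dp).
  - exists (fun _ => 0); split; [now apply A, smooth_const|intros p Dp; now destruct (HS p Dp)]. }
assert (T := smooth_alg D X oD S).
exact (conj (T z Az) (conj (T x Ax) (conj (T y Ay) (conj (T m Am) (T n An))))).
Qed.

Lemma vsmooth_co D z : vsmooth D z <-> forall k, smooth D (fun p => co k (z p)).
Proof.
split.
- intros [H1 [H2 [H3 H4]]] []; assumption.
- intros H; exact (conj (H K1) (conj (H K2) (conj (H K3) (H K4)))).
Qed.

Lemma vpd_eq i z p w : (forall k, is_pd i (fun q => co k (z q)) p (co k w)) -> vpd i z p = w.
Proof. intros H; apply R4_ext; intros k. rewrite co_vpd. now apply is_pd_unique. Qed.

Lemma vsmooth_is_pd D z i p k : vsmooth D z -> D p ->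
  is_pd i (fun q => co k (z q)) p (co k (vpd i z p)).
Proof.
intros H Dp. rewrite co_vpd. exact (smooth_is_pd D _ i p (proj1 (vsmooth_co D z) H k) Dp).
Qed.

Lemma is_pd_mink D a b i p : vsmooth D a -> vsmooth D b -> D p ->
  is_pd i (fun q => mink (a q) (b q)) p (mink (vpd i a p) (b p) + mink (a p) (vpd i b p)).
Proof.
intros Ha Hb Dp.
assert (da := fun k => vsmooth_is_pd D a i p k Ha Dp).
assert (db := fun k => vsmooth_is_pd D b i p k Hb Dp).
generalize (da K1) (da K2) (da K3) (da K4) (db K1) (db K2) (db K3) (db K4).
intros a1 a2 a3 a4 b1 b2 b3 b4. rewrite !mink_co.
change (is_pd i (fun q => co K1 (a q) * co K1 (b q) + co K2 (a q) * co K2 (b q) +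
  co K3 (a q) * co K3 (b q) - co K4 (a q) * co K4 (b q)) p
  (co K1 (vpd i a p) * co K1 (b p) + co K2 (vpd i a p) * co K2 (b p) +
   co K3 (vpd i a p) * co K3 (b p) - co K4 (vpd i a p) * co K4 (b p) +
   (co K1 (a p) * co K1 (vpd i b p) + co K2 (a p) * co K2 (vpd i b p) +
    co K3 (a p) * co K3 (vpd i b p) - co K4 (a p) * co K4 (vpd i b p)))).
pd_solve fail. ring.
Qed.

Lemma mink_pd_constant D a b c i p : open D -> vsmooth D a -> vsmooth D b ->
  (forall q, D q -> mink (a q) (b q) = c) -> D p ->
  mink (vpd i a p) (b p) + mink (a p) (vpd i b p) = 0.
Proof.
intros oD Ha Hb Hc Dp. apply (is_pd_inj i (fun q => mink (a q) (b q)) p).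
- now apply is_pd_mink with D.
- apply (is_pd_on i D (fun _ => c)); trivial; [|apply is_pd_const].
  intros q Dq; symmetry; auto.
Qed.

Lemma vpd_scal_on D a z w i p : open D -> smooth D a -> vsmooth D z -> D p ->
  (forall q, D q -> w q = scal (a q) (z q)) ->
  vpd i w p = plus (scal (pd i a p) (z p)) (scal (a p) (vpd i z p)).
Proof.
intros oD sa sz Dp H. apply vpd_eq. intros k.
apply (is_pd_on i D (fun q => a q * co k (z q))); trivial.
- intros q Dq. now rewrite (H q Dq), co_scal.
- rewrite co_plus, !co_scal.
  assert (H1 := smooth_is_pd D a i p sa Dp). assert (H2 := vsmooth_is_pd D z i p k sz Dp).
  pd_solve fail. ring.
Qed.

Section Construct.

Variables (D : R * R -> Prop) (f g la mu nu : R * R -> R) (F : R * R -> frame).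
Hypothesis dD : domain D.
Hypothesis cpt : compatible D f g la mu nu.
Hypothesis int : integral_frame D f g la mu nu F.
Hypothesis orth : forall p, D p -> orthonormal (F p).

Let z p := pt (F p).
Let x p := vx (F p).
Let y p := vy (F p).
Let m p := vm (F p).
Let n p := vn (F p).
Let oD : open D := cp_open cpt.

Lemma frame_vsmooth : vsmooth D z /\ vsmooth D x /\ vsmooth D y /\ vsmooth D m /\ vsmooth D n.
Proof.
assert (H := fun k => integral_smooth D f g la mu nu _ _ _ _ _ cpt (int k)).
split; [|split; [|split; [|split]]]; apply vsmooth_co; intros k; apply (H k).
Qed.

Lemma frame_vpd p : D p ->
  (vpd Du z p = scal (f p) (x p) /\ vpd Dv z p = scal (f p) (y p)) /\
  (vpd Du x p = plus (scal (pd Du g p) (x p))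
     (plus (scal (f p * la p) (m p)) (scal (f p * mu p) (n p))) /\
   vpd Dv x p = plus (scal (- f p * nu p) (m p)) (scal (- pd Dv g p) (x p))) /\
  (vpd Du y p = plus (scal (- f p * nu p) (m p)) (scal (- pd Du g p) (y p)) /\
   vpd Dv y p = scal (pd Dv g p) (y p)) /\
  (vpd Du m p = plus (scal (- f p * nu p) (x p)) (scal (f p * la p) (y p)) /\
   vpd Dv m p = scal (- f p * nu p) (y p)) /\
  (vpd Du n p = scal (f p * mu p) (y p) /\ vpd Dv n p = zero).
Proof.
intros Dp. assert (H := fun k => proj1 (int k p Dp)).
repeat split; apply vpd_eq; intros k; destruct (H k);
repeat rewrite ?co_plus, ?co_scal, ?co_zero;
(eapply is_pd_val; [eassumption|unfold x, y, m, n; ring]).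
Qed.

Lemma frame_adapted p : D p -> adapted z (f p) (x p) (y p) (m p) (n p) p.
Proof.
intros Dp. destruct (frame_vpd p Dp) as [[Eu Ev] _]. split; trivial.
- now apply cpt.
- now apply orth.
Qed.

Lemma frame_sigma p : D p ->
  sigma z x x p = plus (scal (la p) (m p)) (scal (mu p) (n p)) /\
  sigma z x y p = scal (- nu p) (m p) /\ sigma z y y p = zero.
Proof.
intros Dp. assert (ad := frame_adapted p Dp).
assert (fp := cp_f cpt p Dp).
assert (G := pseudo_orthonormal_gram (orth p Dp)).
change (gram (x p) (y p) (m p) (n p)) in G.
destruct (frame_vpd p Dp) as [[Eu Ev] [[xu xv] [[yu yv] _]]].
assert (X : x p = scal (/ f p) (vpd Du z p)).
{ rewrite Eu. apply R4_ext; intros k; rewrite !co_scal; field; lra. }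
assert (Y : y p = scal (/ f p) (vpd Dv z p)).
{ rewrite Ev. apply R4_ext; intros k; rewrite !co_scal; field; lra. }
rewrite !(adapted_sigma_u ad _ _ _ X), (adapted_sigma_v ad _ _ _ Y).
rewrite !(adapted_normal_part ad), xu, yu, yv.
repeat split; mink_simpl G; apply R4_ext; intros k;
repeat rewrite ?co_scal, ?co_plus, ?co_zero; field; lra.
Qed.

Lemma frame_mean_curv p : D p -> mean_curv z p = scal (nu p) (m p).
Proof.
intros Dp. assert (ad := frame_adapted p Dp).
assert (fp := cp_f cpt p Dp).
assert (G := pseudo_orthonormal_gram (orth p Dp)).
change (gram (x p) (y p) (m p) (n p)) in G.
destruct frame_vsmooth as [sz [sx [sy _]]].
destruct (frame_vpd p Dp) as [_ [[xu xv] [[yu yv] _]]].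
rewrite (adapted_mean_curv ad), !(adapted_normal_part ad).
rewrite (vpd_scal_on D f y (vpd Dv z) Du p), (vpd_scal_on D f x (vpd Du z) Dv p); trivial;
  try apply cpt; try (intros q Dq; apply (frame_vpd q Dq)).
rewrite xv, yu. mink_simpl G. apply R4_ext; intros k.
repeat rewrite ?co_scal, ?co_plus. field; lra.
Qed.

Lemma frame_isotropic : isotropic D z f.
Proof.
split; [apply cpt|]. intros p Dp. assert (ad := frame_adapted p Dp).
rewrite !(adapted_metric ad). split; [now apply cpt|auto].
Qed.

Lemma frame_gauss p : D p -> gauss_curv z p - mink (mean_curv z p) (mean_curv z p) = 0.
Proof.
intros Dp. assert (fp := cp_f cpt p Dp).
assert (G := pseudo_orthonormal_gram (orth p Dp)).
change (gram (x p) (y p) (m p) (n p)) in G.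
rewrite (gauss_curv_isotropic D z f g), frame_mean_curv by
  (trivial; try apply cpt; intros i j q Dq;
   exact (adapted_metric (frame_adapted q Dq) i j)).
rewrite (cp_gauss cpt p Dp). mink_simpl G. field; lra.
Qed.

Lemma frame_timelike : timelike_surface D z.
Proof.
split; [exact dD|split; [split; [apply frame_vsmooth|]|]]; intros p Dp;
assert (ad := frame_adapted p Dp).
- apply (adapted_immersion ad).
- apply (adapted_timelike ad).
Qed.

Lemma frame_geometric : geometric_frame D z f x y m n.
Proof.
destruct frame_vsmooth as [sz [sx [sy [sm sn]]]].
split; [trivial|split; [trivial|split; [|split]]].
- split; trivial. intros p Dp. split.
  + apply (adapted_normal (frame_adapted p Dp)).
  + apply (orth p Dp).
- split; trivial. intros p Dp. split.
  + apply (adapted_normal (frame_adapted p Dp)).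
  + apply (orth p Dp).
- intros p Dp. assert (fp := cp_f cpt p Dp).
  destruct (frame_vpd p Dp) as [[Eu Ev] _].
  split; [now apply orth|split; [|split]].
  + rewrite Eu. apply R4_ext; intros k; rewrite !co_scal; field; lra.
  + rewrite Ev. apply R4_ext; intros k; rewrite !co_scal; field; lra.
  + exists (nu p). now apply frame_mean_curv.
Qed.

Lemma frame_canonical : (forall p, D p -> f p = 1 / sqrt (Rabs (mu p))) ->
  canonical_wrt D z f x y m n la mu nu.
Proof.
intros Hf. split; [apply frame_isotropic|split; [apply frame_geometric|]].
intros p Dp. destruct (frame_sigma p Dp) as [H1 [H2 H3]].
repeat split; trivial; [now apply cpt|auto].
Qed.

Lemma frame_normal_conn_m p w : D p -> tangent z p w -> normal_conn z p w m = zero.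
Proof.
intros Dp [a [b ->]]. assert (ad := frame_adapted p Dp).
assert (G := pseudo_orthonormal_gram (orth p Dp)).
change (gram (x p) (y p) (m p) (n p)) in G.
destruct (frame_vpd p Dp) as [_ [_ [_ [[mu_ mv] _]]]].
unfold normal_conn. rewrite (flat_conn_tangent ad), mu_, mv.
rewrite (adapted_normal_part ad). mink_simpl G.
apply R4_ext; intros k. repeat rewrite ?co_scal, ?co_plus, ?co_zero. ring.
Qed.

(** [H = nu m] with [m] parallel, so the normal derivative of [H] along [u] is
[nu_u m]; the parallel unit field is [m] with the constant sign of [nu]. *)
Lemma frame_parallel_normalized p1 : D p1 -> pd Du nu p1 <> 0 ->
  parallel_normalized_mean_curv D z.
Proof.
intros Dp1 H1. assert (Gr : forall p, D p -> gram (x p) (y p) (m p) (n p)).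
{ intros p Dp; now apply pseudo_orthonormal_gram, orth. }
destruct frame_vsmooth as [sz [sx [sy [sm sn]]]].
split; [|split].
- intros p Dp H. rewrite frame_mean_curv in H by trivial.
  apply (cp_nu cpt p Dp).
  generalize (f_equal (fun w => mink w (m p)) H); cbv beta. mink_simpl (Gr p Dp). lra.
- intros H. apply H1. assert (ad := frame_adapted p1 Dp1).
  assert (T : tangent z p1 (scal 1 (vpd Du z p1))).
  { exists 1, 0. now rewrite (@scal_zero_l R_AbsRing R4), (@plus_zero_r R4). }
  generalize (f_equal (fun w => mink w (m p1)) (H p1 Dp1 _ T)). cbv beta. unfold normal_conn.
  rewrite (flat_conn_u ad), (normal_part_m ad).
  rewrite (vpd_scal_on D nu m (mean_curv z) Du p1); trivial;
    [|apply cpt|intros q Dq; now apply frame_mean_curv].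
  destruct (frame_vpd p1 Dp1) as [_ [_ [_ [[mu_ mv] _]]]]. rewrite mu_.
  mink_simpl (Gr p1 Dp1). lra.
- assert (Hs : exists s, s * s = 1 /\ forall p, D p -> 0 < s * nu p).
  { assert (cn : forall s p, D p -> continuous (fun q => s * nu q) p).
    { intros s p Dp. apply continuous_Rmult; [apply continuous_const|].
      apply smooth_continuous with D; trivial. apply cpt. }
    assert (nz : forall s p, s <> 0 -> D p -> s * nu p <> 0).
    { intros s p Hs Dp.
      apply Rmult_integral_contrapositive_currified; trivial. now apply cpt. }
    destruct (Rdichotomy _ _ (cp_nu cpt p1 Dp1)).
    - exists (-1); split; [ring|]. intros p Dp.
      apply (domain_positive D (fun q => -1 * nu q) dD (cn (-1))) with p1; trivial; [|lra].
      intros q Dq; apply nz; trivial; lra.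
    - exists 1; split; [ring|]. intros p Dp.
      apply (domain_positive D (fun q => 1 * nu q) dD (cn 1)) with p1; trivial; [|lra].
      intros q Dq; apply nz; trivial; lra.
      }
  destruct Hs as [s [ss sn0]].
  exists (fun p => scal s (m p)). split; [split|split].
  + apply vsmooth_co; intros k.
    apply (smooth_on D (fun p => s * co k (m p))); trivial.
    * intros p _; now rewrite co_scal.
    * apply smooth_mult; trivial; [now apply smooth_const|exact (proj1 (vsmooth_co D m) sm k)].
  + intros p Dp. split.
    * intros t Ht. rewrite mink_scal_l.
      rewrite (proj1 (adapted_normal (frame_adapted p Dp)) t Ht). ring.
    * mink_simpl (Gr p Dp). lra.
  + intros p Dp. exists (s * nu p). split; auto.
    rewrite frame_mean_curv by trivial. apply R4_ext; intros k; rewrite !co_scal.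
    rewrite <- (Rmult_1_l (nu p)) at 1. rewrite <- ss. ring.
  + intros p Dp w Hw. assert (ad := frame_adapted p Dp).
    generalize (frame_normal_conn_m p w Dp Hw). destruct Hw as [a [b ->]].
    unfold normal_conn. rewrite !(flat_conn_tangent ad).
    rewrite !(adapted_normal_part ad).
    assert (Es : forall i, vpd i (fun q => scal s (m q)) p = scal s (vpd i m p)).
    { intros i. apply vpd_eq; intros k. rewrite co_scal.
      assert (H2 := vsmooth_is_pd D m i p k sm Dp).
      apply (is_pd_on i D (fun q => s * co k (m q))); trivial.
      - intros q _; now rewrite co_scal.
      - pd_solve fail. ring. }
    rewrite !Es. rewrite !mink_plus_l, !mink_scal_l. intros H.
    apply R4_ext; intros k. generalize (f_equal (co k) H).
    repeat rewrite ?co_scal, ?co_plus, ?co_zero. intros H2.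
    transitivity (s * 0); [rewrite <- H2|]; ring.
Qed.

End Construct.

(** * Every solution is an integral frame field *)

Lemma vpd_comm D z p : open D -> vsmooth D z -> D p ->
  vpd Dv (vpd Du z) p = vpd Du (vpd Dv z) p.
Proof.
intros oD H Dp. assert (Hk := proj1 (vsmooth_co D z) H).
apply R4_ext; intros []; apply (pd_comm D); trivial.
- exact (Hk K1).
- exact (Hk K2).
- exact (Hk K3).
- exact (Hk K4).
Qed.

Section Recover.

Variables (D : R * R -> Prop) (f g la mu nu : R * R -> R).
Variables (z x y m n : R * R -> R4).
Hypothesis cpt : compatible D f g la mu nu.
Hypothesis sz : vsmooth D z.
Hypothesis can : canonical_wrt D z f x y m n la mu nu.
Hypothesis pnm : parallel_normalized_mean_curv D z.

Let oD : open D := cp_open cpt.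

Lemma recover_vsmooth : vsmooth D x /\ vsmooth D y /\ vsmooth D m /\ vsmooth D n.
Proof.
destruct can as [_ [[sx [sy [[sm _] [[sn _] _]]]] _]].
exact (conj sx (conj sy (conj sm sn))).
Qed.

Lemma recover_adapted p : D p -> adapted z (f p) (x p) (y p) (m p) (n p) p.
Proof.
intros Dp. destruct can as [_ [[_ [_ [_ [_ H]]]] _]].
destruct (H p Dp) as [O [Ex [Ey _]]]. assert (fp := cp_f cpt p Dp).
split; trivial.
- rewrite Ex. apply R4_ext; intros k; rewrite !co_scal; field; lra.
- rewrite Ey. apply R4_ext; intros k; rewrite !co_scal; field; lra.
Qed.

Lemma recover_gram p : D p -> gram (x p) (y p) (m p) (n p).
Proof. intros Dp; apply pseudo_orthonormal_gram, (recover_adapted p Dp). Qed.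

(** The second derivative of the position vector is symmetric: this carries the
products of [y_u] with the frame over to [x_v]. *)
Lemma recover_mixed p : D p ->
  plus (scal (pd Dv f p) (x p)) (scal (f p) (vpd Dv x p)) =
  plus (scal (pd Du f p) (y p)) (scal (f p) (vpd Du y p)).
Proof.
intros Dp. destruct recover_vsmooth as [sx [sy _]].
assert (sf := cp_sf cpt).
rewrite <- (vpd_scal_on D f x (vpd Du z) Dv p) by
  (trivial; intros q Dq; apply (recover_adapted q Dq)).
rewrite <- (vpd_scal_on D f y (vpd Dv z) Du p) by
  (trivial; intros q Dq; apply (recover_adapted q Dq)).
now apply (vpd_comm D).
Qed.

Lemma recover_sigma p : D p ->
  (mink (vpd Du x p) (m p) = f p * la p /\ mink (vpd Du x p) (n p) = f p * mu p) /\
  (mink (vpd Du y p) (m p) = - f p * nu p /\ mink (vpd Du y p) (n p) = 0) /\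
  (mink (vpd Dv y p) (m p) = 0 /\ mink (vpd Dv y p) (n p) = 0).
Proof.
intros Dp. assert (ad := recover_adapted p Dp). assert (G := recover_gram p Dp).
assert (fp := cp_f cpt p Dp).
destruct can as [_ [[_ [_ [_ [_ H]]]] Hs]].
destruct (H p Dp) as [_ [X [Y _]]]. destruct (Hs p Dp) as [Sxx [Sxy [Syy _]]].
rewrite (adapted_sigma_u ad _ _ _ X) in Sxx.
rewrite (adapted_sigma_u ad _ _ _ X) in Sxy.
rewrite (adapted_sigma_v ad _ _ _ Y) in Syy.
assert (S : forall w v, scal (/ f p) (normal_part z p w) = v ->
  mink w (m p) = f p * mink v (m p) /\ mink w (n p) = f p * mink v (n p)).
{ intros w v <-. rewrite !mink_scal_l, (normal_part_m ad),
    (normal_part_n ad). split; field; lra. }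
destruct (S _ _ Sxx) as [-> ->]. destruct (S _ _ Sxy) as [-> ->].
destruct (S _ _ Syy) as [-> ->].
repeat split; mink_simpl G; ring.
Qed.

Lemma recover_mean_curv p : D p -> mean_curv z p = scal (nu p) (m p).
Proof.
intros Dp. assert (ad := recover_adapted p Dp). assert (G := recover_gram p Dp).
assert (fp := cp_f cpt p Dp).
destruct recover_vsmooth as [sx [sy _]].
destruct (recover_sigma p Dp) as [_ [[Ym Yn] _]].
rewrite (adapted_mean_curv ad), (vpd_comm D) by trivial.
rewrite (vpd_scal_on D f y (vpd Dv z) Du p) by
  (trivial; try apply cpt; intros q Dq; apply (recover_adapted q Dq)).
rewrite !(adapted_normal_part ad), !mink_plus_l, !mink_scal_l, Ym, Yn.
mink_simpl G.
apply R4_ext; intros k. repeat rewrite ?co_scal, ?co_plus. field; lra.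
Qed.

(** The unit normal field of the hypothesis is [m] up to sign, hence its
parallelism gives that of [m]; the sign itself is never differentiated. *)
Lemma recover_parallel i p : D p -> mink (vpd i m p) (n p) = 0.
Proof.
intros Dp. assert (ad := recover_adapted p Dp).
destruct recover_vsmooth as [_ [_ [sm sn]]].
destruct pnm as [_ [_ [e [[se _] [He par]]]]].
assert (eb : forall q w, D q -> exists c, 0 < c /\ c * mink (e q) w = nu q * mink (m q) w).
{ intros q w Dq. destruct (He q Dq) as [c [c0 Hc]]. exists c; split; trivial.
  rewrite recover_mean_curv in Hc by trivial.
  rewrite <- (mink_scal_l c), <- (mink_scal_l (nu q)).
  exact (f_equal (fun v => mink v w) (eq_sym Hc)). }
assert (en : forall q, D q -> mink (e q) (n q) = 0).
{ intros q Dq. destruct (eb q (n q) Dq) as [c [c0 Hc]].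
  rewrite (g_mn (recover_gram q Dq)), Rmult_0_r in Hc.
  destruct (Rmult_integral _ _ Hc); lra. }
assert (T : tangent z p (vpd i z p)).
{ destruct i; [exists 1, 0|exists 0, 1];
  rewrite (@scal_zero_l R_AbsRing R4), (@scal_one R_AbsRing R4);
  now rewrite ?(@plus_zero_r R4), ?(@plus_zero_l R4). }
assert (P : mink (vpd i e p) (n p) = 0).
{ generalize (f_equal (fun w => mink w (n p)) (par p Dp _ T)). cbv beta. unfold normal_conn.
  rewrite (normal_part_n ad), mink_zero_l.
  replace (vpd i z p) with (scal 1 (vpd i z p)) by apply (@scal_one R_AbsRing R4).
  destruct i; rewrite ?(flat_conn_u ad), ?(flat_conn_v ad);
  now rewrite (@scal_one R_AbsRing R4). }
generalize (mink_pd_constant D e n 0 i p oD se sn en Dp). rewrite P, Rplus_0_l. intros Q.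
destruct (eb p (vpd i n p) Dp) as [c [c0 Hc]]. rewrite Q, Rmult_0_r in Hc.
generalize (mink_pd_constant D m n 0 i p oD sm sn
  (fun q Dq => g_mn (recover_gram q Dq)) Dp).
destruct (Rmult_integral _ _ (eq_sym Hc)) as [H|H].
- now apply (cp_nu cpt) in H.
- rewrite H. lra.
Qed.

(** The products of each derivative with the frame come from the second
fundamental form, from the parallel normal field, from [recover_mixed], and
otherwise from differentiating the constant products of the frame vectors. *)
Lemma recover_vpd p : D p ->
  (vpd Du x p = plus (scal (pd Du g p) (x p))
     (plus (scal (f p * la p) (m p)) (scal (f p * mu p) (n p))) /\
   vpd Dv x p = plus (scal (- f p * nu p) (m p)) (scal (- pd Dv g p) (x p))) /\
  (vpd Du y p = plus (scal (- f p * nu p) (m p)) (scal (- pd Du g p) (y p)) /\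
   vpd Dv y p = scal (pd Dv g p) (y p)) /\
  (vpd Du m p = plus (scal (- f p * nu p) (x p)) (scal (f p * la p) (y p)) /\
   vpd Dv m p = scal (- f p * nu p) (y p)) /\
  (vpd Du n p = scal (f p * mu p) (y p) /\ vpd Dv n p = zero).
Proof.
intros Dp. assert (G := recover_gram p Dp).
assert (fp := cp_f cpt p Dp).
assert (E := pseudo_orthonormal_expansion (ad_po (recover_adapted p Dp))).
destruct recover_vsmooth as [sx [sy [sm sn]]].
assert (Gr := fun q Dq => recover_gram q Dq).
assert (xx := fun i => mink_pd_constant D x x _ i p oD sx sx (fun q Dq => g_xx (Gr q Dq)) Dp).
assert (yy := fun i => mink_pd_constant D y y _ i p oD sy sy (fun q Dq => g_yy (Gr q Dq)) Dp).
assert (xy := fun i => mink_pd_constant D x y _ i p oD sx sy (fun q Dq => g_xy (Gr q Dq)) Dp).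
assert (mm := fun i => mink_pd_constant D m m _ i p oD sm sm (fun q Dq => g_mm (Gr q Dq)) Dp).
assert (nn := fun i => mink_pd_constant D n n _ i p oD sn sn (fun q Dq => g_nn (Gr q Dq)) Dp).
assert (xm := fun i => mink_pd_constant D x m _ i p oD sx sm (fun q Dq => g_xm (Gr q Dq)) Dp).
assert (xn := fun i => mink_pd_constant D x n _ i p oD sx sn (fun q Dq => g_xn (Gr q Dq)) Dp).
assert (ym := fun i => mink_pd_constant D y m _ i p oD sy sm (fun q Dq => g_ym (Gr q Dq)) Dp).
assert (yn := fun i => mink_pd_constant D y n _ i p oD sy sn (fun q Dq => g_yn (Gr q Dq)) Dp).
assert (mn := fun i => mink_pd_constant D m n _ i p oD sm sn (fun q Dq => g_mn (Gr q Dq)) Dp).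
destruct (recover_sigma p Dp) as [[xum xun] [[yum yun] [yvm yvn]]].
assert (pa := fun i => recover_parallel i p Dp).
assert (mix := recover_mixed p Dp).
rewrite !(cp_df cpt) in mix by trivial.
assert (mixw := fun w => f_equal (fun v => mink v w) mix). cbv beta in mixw.
assert (mx := mixw (x p)). assert (my := mixw (y p)).
assert (m_m := mixw (m p)). assert (m_n := mixw (n p)).
clear mix mixw.
repeat rewrite ?mink_plus_l, ?mink_scal_l in mx, my, m_m, m_n.
destruct G as [Gxx Gyy Gxy Gmm Gnn Gmn Gxm Gxn Gym Gyn].
assert (Gyx := Gxy). rewrite mink_sym in Gyx.
rewrite ?Gxx, ?Gyy, ?Gxy, ?Gyx, ?Gxm, ?Gym, ?Gxn, ?Gyn, ?xum, ?xun, ?yum, ?yun in *.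
assert (tw : forall i (a b : R * R -> R4), mink (a p) (vpd i b p) = mink (vpd i b p) (a p))
  by (intros; apply mink_sym).
assert (xu := xx Du). assert (xv := xx Dv). assert (yu := yy Du). assert (yv := yy Dv).
assert (xyu := xy Du). assert (xyv := xy Dv). assert (mmu := mm Du). assert (mmv := mm Dv).
assert (nnu := nn Du). assert (nnv := nn Dv). assert (xmu := xm Du). assert (xmv := xm Dv).
assert (xnu := xn Du). assert (xnv := xn Dv). assert (ymu := ym Du). assert (ymv := ym Dv).
assert (ynu := yn Du). assert (ynv := yn Dv). assert (mnu := mn Du). assert (mnv := mn Dv).
assert (pau := pa Du). assert (pav := pa Dv).
rewrite !tw in xu, xv, yu, yv, xyu, xyv, mmu, mmv, nnu, nnv, xmu, xmv, xnu, xnv,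
  ymu, ymv, ynu, ynv, mnu, mnv.
clear xx yy xy mm nn xm xn ym yn mn pa tw.
set (gu := pd Du g p) in *. set (gv := pd Dv g p) in *.
assert (cancel : forall t s, f p * t = f p * s -> t = s).
{ intros t s H; apply (Rmult_eq_reg_l (f p)); [exact H|lra]. }
assert (Xux : mink (vpd Du x p) (x p) = 0) by lra.
assert (Xvx : mink (vpd Dv x p) (x p) = 0) by lra.
assert (Yuy : mink (vpd Du y p) (y p) = 0) by lra.
assert (Yvy : mink (vpd Dv y p) (y p) = 0) by lra.
rewrite Xvx in mx. rewrite Yuy in my.
assert (Yux : mink (vpd Du y p) (x p) = gu) by (apply cancel; lra).
assert (Xvy : mink (vpd Dv x p) (y p) = gv) by (apply cancel; lra).
assert (Xuy : mink (vpd Du x p) (y p) = - gu) by lra.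
assert (Yvx : mink (vpd Dv y p) (x p) = - gv) by lra.
assert (Xvm : mink (vpd Dv x p) (m p) = - f p * nu p) by (apply cancel; lra).
assert (Xvn : mink (vpd Dv x p) (n p) = 0) by (apply cancel; lra).
assert (Mux : mink (vpd Du m p) (x p) = - (f p * la p)) by lra.
assert (Mvx : mink (vpd Dv m p) (x p) = f p * nu p) by lra.
assert (Muy : mink (vpd Du m p) (y p) = f p * nu p) by lra.
assert (Mvy : mink (vpd Dv m p) (y p) = 0) by lra.
assert (Mum : mink (vpd Du m p) (m p) = 0) by lra.
assert (Mvm : mink (vpd Dv m p) (m p) = 0) by lra.
assert (Nux : mink (vpd Du n p) (x p) = - (f p * mu p)) by lra.
assert (Nvx : mink (vpd Dv n p) (x p) = 0) by lra.
assert (Nuy : mink (vpd Du n p) (y p) = 0) by lra.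
assert (Nvy : mink (vpd Dv n p) (y p) = 0) by lra.
assert (Num : mink (vpd Du n p) (m p) = 0) by lra.
assert (Nvm : mink (vpd Dv n p) (m p) = 0) by lra.
assert (Nun : mink (vpd Du n p) (n p) = 0) by lra.
assert (Nvn : mink (vpd Dv n p) (n p) = 0) by lra.
repeat split; apply R4_ext; intros k;
(match goal with |- co _ ?w = _ => rewrite (E w k) end);
rewrite ?Xux, ?Xvx, ?Yuy, ?Yvy, ?Yux, ?Xvy, ?Xuy, ?Yvx, ?xum, ?xun, ?Xvm, ?Xvn, ?yum, ?yun,
  ?yvm, ?yvn, ?Mux, ?Mvx, ?Muy, ?Mvy, ?Mum, ?Mvm, ?pau, ?pav, ?Nux, ?Nvx, ?Nuy, ?Nvy,
  ?Num, ?Nvm, ?Nun, ?Nvn;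
repeat rewrite ?co_scal, ?co_plus, ?co_zero; ring.
Qed.

Lemma recover_frame_eqs p : D p ->
  frame_eqs f g la mu nu (fun q => Frame (z q) (x q) (y q) (m q) (n q)) p.
Proof.
intros Dp k. destruct recover_vsmooth as [sx [sy [sm sn]]].
destruct (recover_vpd p Dp) as [[xu xv] [[yu yv] [[mu_ mv] [nu_ nv]]]].
assert (ad := recover_adapted p Dp).
assert (zu := ad_u ad). assert (zv := ad_v ad).
assert (V : forall i a w, vsmooth D a -> vpd i a p = w ->
  is_pd i (fun q => co k (a q)) p (co k w)).
{ intros i a w sa <-. now apply vsmooth_is_pd with D. }
split; cbn [pt vx vy vm vn];
[ generalize (V _ _ _ sz zu) | generalize (V _ _ _ sz zv)
| generalize (V _ _ _ sx xu) | generalize (V _ _ _ sx xv)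
| generalize (V _ _ _ sy yu) | generalize (V _ _ _ sy yv)
| generalize (V _ _ _ sm mu_) | generalize (V _ _ _ sm mv)
| generalize (V _ _ _ sn nu_) | generalize (V _ _ _ sn nv) ];
intros H; (eapply is_pd_val; [exact H|]); repeat rewrite ?co_scal, ?co_plus, ?co_zero; ring.
Qed.

End Recover.

(** * Existence and uniqueness *)

Lemma compatible_sub (D S : R * R -> Prop) f g la mu nu : open S ->
  (forall p, S p -> D p) -> compatible D f g la mu nu -> compatible S f g la mu nu.
Proof.
intros oS SD []; split; trivial; try (now apply smooth_sub with D); intros; auto.
Qed.

Lemma canonical_wrt_metric D z f f' x y m n la mu nu :
  smooth D f -> (forall p, D p -> f' p = f p) ->
  canonical_wrt D z f' x y m n la mu nu -> canonical_wrt D z f x y m n la mu nu.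
Proof.
intros sf E [[_ iso] [[sx [sy [nm [nn fr]]]] H]].
split; [|split; [split; [trivial|split; [trivial|split; [trivial|split; [trivial|]]]]|]].
- split; trivial. intros p Dp. rewrite <- (E p Dp); auto.
- intros p Dp. rewrite <- (E p Dp); auto.
- intros p Dp. rewrite <- (E p Dp); auto.
Qed.

Lemma exp_half_ln t : 0 < t -> exp (- / 2 * ln t) = 1 / sqrt t.
Proof.
intros Ht. change (Rpower t (- / 2) = 1 / sqrt t).
rewrite Rpower_Ropp, Rpower_sqrt by trivial. unfold Rdiv; ring.
Qed.

Section Data.

Variables (D : R * R -> Prop) (la mu nu : R * R -> R).
Hypothesis oD : open D.
Hypothesis sla : smooth D la.
Hypothesis smu : smooth D mu.
Hypothesis snu : smooth D nu.
Hypothesis mu0 : forall p, D p -> mu p <> 0.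
Hypothesis nu0 : forall p, D p -> nu p <> 0.
Hypothesis nuv : forall p, D p -> pd Dv nu p = 0.
Hypothesis eq1 : forall p, D p ->
  pd Du nu p + pd Dv la p = la p * pd Dv (fun q => ln (Rabs (mu q))) p.
Hypothesis eq2 : forall p, D p ->
  Rabs (mu p) * pd Dv (pd Du (fun q => ln (Rabs (mu q)))) p = - nu p ^ 2.

Definition log_metric (p : R * R) : R := - / 2 * ln (Rabs (mu p)).
Definition metric_fun (p : R * R) : R := exp (log_metric p).

Lemma metric_fun_sqrt p : D p -> metric_fun p = 1 / sqrt (Rabs (mu p)).
Proof. intros Dp. apply exp_half_ln. now apply Rabs_pos_lt, mu0. Qed.

Lemma log_metric_is_pd i p : D p ->
  is_pd i log_metric p (- / 2 * pd i (fun q => ln (Rabs (mu q))) p).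
Proof.
intros Dp. assert (H := smooth_is_pd D _ i p (smooth_ln_abs D mu oD smu mu0) Dp).
unfold log_metric. pd_solve ltac:(idtac; lra). ring.
Qed.

Lemma data_compatible : compatible D metric_fun log_metric la mu nu.
Proof.
assert (sl := smooth_ln_abs D mu oD smu mu0).
assert (sg : smooth D log_metric).
{ apply smooth_mult; trivial. now apply smooth_const. }
assert (dl : forall i p, D p -> pd i (fun q => ln (Rabs (mu q))) p = pd i mu p / mu p).
{ intros i p Dp. apply is_pd_unique, is_pd_ln_abs with D; auto. }
assert (dg : forall i p, D p ->
  pd i log_metric p = - / 2 * pd i (fun q => ln (Rabs (mu q))) p).
{ intros i p Dp. now apply is_pd_unique, log_metric_is_pd. }
split; trivial.
- now apply smooth_exp.
- intros; apply exp_pos.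
- intros i p Dp. apply is_pd_unique. apply is_pd_comp; [apply is_derive_exp|].
  now apply smooth_is_pd with D.
- intros i p Dp. rewrite dg, dl by trivial. field; auto.
- intros p Dp. rewrite eq1, dg by trivial. field.
- intros p Dp.
  assert (Hg : pd Dv (pd Du log_metric) p =
    - / 2 * pd Dv (pd Du (fun q => ln (Rabs (mu q)))) p).
  { apply is_pd_unique.
    apply (is_pd_on Dv D (fun q => - / 2 * pd Du (fun q => ln (Rabs (mu q))) q)); trivial.
    - intros q Dq; symmetry; auto.
    - assert (H := smooth_is_pd D _ Dv p (smooth_pd _ _ Du sl) Dp).
      pd_solve ltac:(idtac; lra). ring. }
  assert (Hm : 0 < Rabs (mu p)) by now apply Rabs_pos_lt, mu0.
  assert (Hs : sqrt (Rabs (mu p)) <> 0) by (apply Rgt_not_eq; now apply sqrt_lt_R0).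
  rewrite Hg, metric_fun_sqrt by trivial.
  replace ((1 / sqrt (Rabs (mu p))) ^ 2) with (/ Rabs (mu p)).
  + apply (Rmult_eq_reg_l (Rabs (mu p))); [|lra].
    transitivity (- (Rabs (mu p) * pd Dv (pd Du (fun q => ln (Rabs (mu q)))) p)); [field|].
    rewrite eq2 by trivial. field; lra.
  + rewrite <- (sqrt_sqrt (Rabs (mu p))) at 1 by lra. now field.
Qed.

End Data.

Theorem theorem4p2 (D : R * R -> Prop) (la mu : R * R -> R) (nu : R -> R)
  (hD : domain D)
  (hla : smooth D la) (hmu : smooth D mu)
  (hnu : smooth D (fun p => nu (fst p)))
  (hmu0 : forall p, D p -> mu p <> 0)
  (hnu0 : forall p, D p -> nu (fst p) <> 0)
  (hnuc : ~ (exists c, forall p, D p -> nu (fst p) = c))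
  (heq1 : forall p, D p ->
     pd Du (fun q => nu (fst q)) p + pd Dv la p =
     la p * pd Dv (fun q => ln (Rabs (mu q))) p)
  (heq2 : forall p, D p ->
     Rabs (mu p) * pd Dv (pd Du (fun q => ln (Rabs (mu q)))) p =
     - nu (fst p) ^ 2)
  (p0 : R * R) (hp0 : D p0)
  (P0 x0 y0 n10 n20 : R4) (hframe : pseudo_orthonormal x0 y0 n10 n20) :
  exists D0 : R * R -> Prop,
    domain D0 /\ D0 p0 /\ (forall p, D0 p -> D p) /\
    let solution (z : R * R -> R4) :=
      timelike_surface D0 z /\
      parallel_normalized_mean_curv D0 z /\
      z p0 = P0 /\
      (forall p, D0 p ->
         gauss_curv z p - mink (mean_curv z p) (mean_curv z p) = 0) /\
      canonical D0 z /\
      (exists f x y n1 n2,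
         canonical_wrt D0 z f x y n1 n2 la mu (fun p => nu (fst p)) /\
         x p0 = x0 /\ y p0 = y0 /\ n1 p0 = n10 /\ n2 p0 = n20) in
    exists z, solution z /\
      forall z', solution z' -> forall p, D0 p -> z' p = z p.
Proof.
assert (oD : open D) by apply hD.
set (nu' := fun p : R * R => nu (fst p)) in *.
assert (nuv : forall p, is_pd Dv nu' p 0) by (intros p; exact (is_pd_const Dv (nu (fst p)) p)).
set (g := log_metric mu). set (f := metric_fun mu).
assert (cpt : compatible D f g la mu nu').
{ apply data_compatible; trivial. intros p _; now apply is_pd_unique. }
assert (Hp1 : exists p1, D p1 /\ pd Du nu' p1 <> 0).
{ apply NNPP; intros H. apply hnuc. exists (nu' p0). intros p Dp.
  apply (domain_constant D nu'); trivial. intros [] q Dq; [|apply nuv].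
  eapply is_pd_val; [now apply smooth_is_pd with D|].
  apply NNPP; intros H'; apply H; now exists q. }
destruct Hp1 as [p1 [Dp1 Hp1]].
destruct (chain_reaches D (patch f g la mu nu' D)) with (p := p0) (q := p1)
  as [U [Q [C Qp1]]]; trivial.
{ intros Q [[oQ _] _]; exact oQ. }
{ now apply patch_exists. }
set (S := union U Q). set (F0 := Frame P0 x0 y0 n10 n20).
assert (dS : domain S).
{ apply (chain_domain (patch f g la mu nu' D) p0); trivial. now intros R [? _]. }
assert (SD : forall p, S p -> D p).
{ apply (chain_sub D (patch f g la mu nu' D) p0); trivial. intros R [_ [_ [HR _]]]; exact HR. }
assert (Sp0 : S p0) by exact (chain_in _ _ _ _ C).
assert (Sp1 : S p1) by now right.
assert (cS : compatible S f g la mu nu').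
{ apply (compatible_sub D S); trivial. apply dS. }
destruct (chain_integral f g la mu nu' D p0 F0 U Q hframe C) as [F [HF EF]].
fold S in HF.
assert (OF : forall p, S p -> orthonormal (F p)).
{ apply (orthonormal_propagates f g la mu nu' S F dS) with p0; trivial.
  - now apply integral_frame_eqs.
  - rewrite EF. exact hframe. }
assert (fS : forall p, S p -> f p = 1 / sqrt (Rabs (mu p))).
{ intros p Sp. apply (metric_fun_sqrt D); auto. }
assert (can := frame_canonical S f g la mu nu' F cS HF OF fS).
exists S. split; [trivial|split; [trivial|split; [trivial|]]].
intros solution. exists (fun p => pt (F p)). split.
- split; [now apply (frame_timelike S f g la mu nu')|].
  split; [now apply (frame_parallel_normalized S f g la mu nu' F) with p1|].
  split; [now rewrite EF|].
  split; [now apply (frame_gauss S f g la mu nu' F)|].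
  split.
  + exists f, (fun p => vx (F p)), (fun p => vy (F p)), (fun p => vm (F p)), (fun p => vn (F p)).
    now exists la, mu, nu'.
  + exists f, (fun p => vx (F p)), (fun p => vy (F p)), (fun p => vm (F p)), (fun p => vn (F p)).
    rewrite EF. now split.
- intros z [[_ [[sz _] _]] [pnm [z0 [_ [_ sol]]]]] p Sp.
  destruct sol as [f' [x [y [n1 [n2 [can' [Ex [Ey [E1 E2]]]]]]]]].
  assert (Ef : forall q, S q -> f' q = f q).
  { intros q Sq. rewrite fS by trivial. apply (proj2 (proj2 can') q Sq). }
  apply (canonical_wrt_metric S z f f') in can'; trivial; [|apply cS].
  set (F' := fun q => Frame (z q) (x q) (y q) (n1 q) (n2 q)).
  change (pt (F' p) = pt (F p)). f_equal.
  apply (integral_frame_unique f g la mu nu' S F F' dS) with p0; trivial.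
  + now apply integral_frame_eqs.
  + intros q Sq. now apply (recover_frame_eqs S).
  + rewrite EF. exact hframe.
  + rewrite EF. unfold F', F0. now rewrite z0, Ex, Ey, E1, E2.
Qed.
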